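(* There is an algorithm (a segmented version of the sieve of Eratosthenes) which, given an integer $x \ge 3$, produces the complete prime factorization of every positive integer $n \le x$ using at most $O(x \log\log x)$ arithmetic operations and at most $O(\sqrt{x}/\log\log x)$ bits of working space, where the implied constants are absolute.
   Context: Model of computation: time is measured as the number of arithmetic (and bitwise/shift) operations on integers of $O(\log x)$ bits; space is measured in bits of working memory. The output (the factorizations) is not counted toward the space bound: it may be streamed out or consumed as it is generated, so the algorithm need not store the factorizations of all $n \le x$ simultaneously. The complete prime factorization of $n$ means the list of the distinct primes dividing $n$ together with their exponents. *)

(* Defs.v *)
From mathcomp Require Import all_boot.
Set Implicit Arguments. Unset Strict Implicit. Unset Printing Implicit Defensive.

(* A simple random-access machine.  Memory is a growable array of natural
   numbers (cells); every instruction is one arithmetic / bitwise / shift /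
   control operation, so time = number of executed instructions. *)
Inductive binop := OAdd | OSub | OMul | ODiv | OMod | OAnd | OOr | OXor | OShl | OShr.

Definition eval_binop (o : binop) (a b : nat) : nat :=
  match o with
  | OAdd => a + b | OSub => a - b | OMul => a * b
  | ODiv => a %/ b | OMod => a %% b
  | OAnd => Nat.land a b | OOr => Nat.lor a b | OXor => Nat.lxor a b
  | OShl => a * 2 ^ b | OShr => a %/ 2 ^ b
  end.

Inductive instr :=
  | IConst (d c : nat)
  | IOp (o : binop) (d a b : nat)
  | ILoad (d a : nat)
  | IStore (a s : nat)
  | IJz (r l : nat)
  | IJmp (l : nat)
  | IOut (r : nat)              (* append mem[r] to the (uncounted) output stream *)
  | IHalt.

Definition program := seq instr.

Record config := Config { pc : nat; cells : seq nat }.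

Definition rd (m : seq nat) (i : nat) : nat := nth 0 m i.
Definition wr (m : seq nat) (i v : nat) : seq nat := set_nth 0 m i v.

Definition step (P : program) (c : config) : option (config * seq nat) :=
  let m := cells c in let n := (pc c).+1 in
  match nth IHalt P (pc c) with
  | IConst d k => Some (Config n (wr m d k), [::])
  | IOp o d a b => Some (Config n (wr m d (eval_binop o (rd m a) (rd m b))), [::])
  | ILoad d a => Some (Config n (wr m d (rd m (rd m a))), [::])
  | IStore a s => Some (Config n (wr m (rd m a) (rd m s)), [::])
  | IJz r l => Some (Config (if rd m r == 0 then l else n) m, [::])
  | IJmp l => Some (Config l m, [::])
  | IOut r => Some (Config n m, [:: rd m r])
  | IHalt => None
  end.

Inductive exec (P : program) : config -> seq config -> seq nat -> Prop :=
  | exec_halt c : step P c = None -> exec P c [:: c] [::]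
  | exec_step c c' o tr out :
      step P c = Some (c', o) -> exec P c' tr out -> exec P c (c :: tr) (o ++ out).

Definition bitlen (v : nat) : nat := if v is 0 then 0 else (trunc_log 2 v).+1.

Definition space (m : seq nat) : nat := sumn (map (fun v => (bitlen v).+1) m).

(* Output format: for each n, the block  n, k, p_1, e_1, ..., p_k, e_k  where
   (p_i, e_i) lists the distinct primes of n with exponents (any order). *)
Definition fact_block (n : nat) (f : seq (nat * nat)) : seq nat :=
  n :: size f :: flatten [seq [:: pe.1; pe.2] | pe <- f].

Definition correct_factorizations (x : nat) (out : seq nat) : Prop :=
  exists (ns : seq nat) (f : nat -> seq (nat * nat)),
    perm_eq ns (iota 1 x) /\
    (forall n, perm_eq (f n) (prime_decomp n)) /\
    out = flatten [seq fact_block n (f n) | n <- ns].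

(* Main.v *)
Require Import Defs.
From Stdlib Require Import Reals Lra.
From mathcomp Require Import all_boot.
From mathcomp Require Import zify.
Set Implicit Arguments. Unset Strict Implicit. Unset Printing Implicit Defensive.

(* Choose k and l with 4^(k-1) <= x < 4^k and 2^(l-1) <= k < 2^l, so that k is of
   order log x and l of order log log x, and put r = 2^k, of order sqrt x.
   - The primes below r are found by naive trial division, in time O(r^2) = O(x),
     and only their gaps are stored.  There are O(r/k) of them by Chebyshev's
     bound, and a gap d takes at most l + d/2^l bits, so all the gaps take
     O(r l/k + r/2^l) = O(r/l) bits.
   - The integers up to x are processed in segments of length L of order r/(k l).
     Each integer n of a segment owns a row of 2k cells, in which its prime factors
     below r are collected.  The product of these primes is at most n, so a row
     takes O(k) bits and a segment O(L k) = O(r/l) bits.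
   - After division by these primes what remains of n is 1 or a prime, as x < r^2.
   - Each segment costs O(r/k) plus the total number of prime factors of its
     members.  There are O(x k l/r) segments, and by Chebyshev's bound on dyadic
     blocks the sum of Omega(n) over n <= x is O(x log log x), so the time is
     O(x l). *)

(** * Structured programs and their compilation *)

(** Both budgets are tight. Storing the primes themselves would take about [k] bits for each of
    about [r/k] primes, so [r] bits, a factor [l] too many; hence the gaps. The segment length is
    forced up to a constant: the rows need [L k = O(r/l)], while running through [r/k] primes in
    each of [x/L] segments in time [O(x l)] needs [L] of order at least [r/(k l)]. Space and word
    size must be controlled at every moment of the run, not only at its end. The semantics therefore
    carries a bound [B] on registers and a predicate [G] on the heap, checked whenever one of them
    is written. The space bound then becomes a statement about a single memory satisfying [G],
    independent of the run. The instruction set has neither comparison nor copy: truncated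
    subtraction [a - b] is nonzero exactly when [b < a], and multiplication by the register [vone]
    copies. *)

Inductive cmd :=
  | Prim of instr
  | Skip
  | Seq of cmd & cmd
  | If of nat & cmd & cmd
  | While of cmd & nat & cmd.

Coercion Prim : instr >-> cmd.
Local Notation "c1 ;; c2" := (Seq c1 c2) (at level 61, right associativity).

(** Jump targets are absolute, so [n] is the address at which the code will be placed. In
    [While c r b] the command [c] recomputes the guard [r] before every test. *)
Fixpoint compile (c : cmd) (n : nat) : seq instr :=
  match c with
  | Prim i => [:: i]
  | Skip => [::]
  | Seq c1 c2 => let s1 := compile c1 n in s1 ++ compile c2 (n + size s1)
  | If r c1 c2 =>
      let s1 := compile c1 n.+1 in let n2 := (n + size s1).+2 in
      let s2 := compile c2 n2 in
      IJz r n2 :: s1 ++ IJmp (n2 + size s2) :: s2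
  | While c r b =>
      let s1 := compile c n in let n2 := (n + size s1).+1 in
      let s2 := compile b n2 in
      s1 ++ IJz r (n2 + size s2).+1 :: s2 ++ [:: IJmp n]
  end.

(* Registers and heap; the memory of the machine is their concatenation. *)
Definition state := (seq nat * seq nat)%type.
Definition reg (s : state) (r : nat) := nth 0 s.1 r.

Section Semantics.
Variables (B : nat) (G : seq nat -> Prop).

(** Only register writes can violate [B] and only stores can violate [G], so just these rules have
    such side conditions. Addresses have the form [size rg + i], which keeps loads and stores away
    from the registers. The extra successors in the times are the jumps inserted by [compile]. *)
Inductive bigstep : cmd -> state -> nat -> seq nat -> state -> Prop :=
  | bigstep_const rg h d v : d < size rg -> v <= B ->
      bigstep (IConst d v) (rg, h) 1 [::] (set_nth 0 rg d v, h)
  | bigstep_op rg h o d a b : d < size rg -> a < size rg -> b < size rg ->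
      eval_binop o (nth 0 rg a) (nth 0 rg b) <= B ->
      bigstep (IOp o d a b) (rg, h) 1 [::]
         (set_nth 0 rg d (eval_binop o (nth 0 rg a) (nth 0 rg b)), h)
  | bigstep_load rg h d a i : d < size rg -> a < size rg ->
      nth 0 rg a = size rg + i -> nth 0 h i <= B ->
      bigstep (ILoad d a) (rg, h) 1 [::] (set_nth 0 rg d (nth 0 h i), h)
  | bigstep_store rg h a s i : a < size rg -> s < size rg ->
      nth 0 rg a = size rg + i -> G (set_nth 0 h i (nth 0 rg s)) ->
      bigstep (IStore a s) (rg, h) 1 [::] (rg, set_nth 0 h i (nth 0 rg s))
  | bigstep_out rg h r : r < size rg ->
      bigstep (IOut r) (rg, h) 1 [:: nth 0 rg r] (rg, h)
  | bigstep_skip s : bigstep Skip s 0 [::] s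
  | bigstep_seq c1 c2 s1 s2 s3 t1 t2 o1 o2 :
      bigstep c1 s1 t1 o1 s2 -> bigstep c2 s2 t2 o2 s3 ->
      bigstep (c1 ;; c2) s1 (t1 + t2) (o1 ++ o2) s3
  | bigstep_if0 r c1 c2 s t o s' : r < size s.1 -> reg s r = 0 ->
      bigstep c2 s t o s' -> bigstep (If r c1 c2) s t.+1 o s'
  | bigstep_if1 r c1 c2 s t o s' : r < size s.1 -> reg s r <> 0 ->
      bigstep c1 s t o s' -> bigstep (If r c1 c2) s t.+2 o s'
  | bigstep_while0 c r b s1 t o s2 : r < size s2.1 ->
      bigstep c s1 t o s2 -> reg s2 r = 0 ->
      bigstep (While c r b) s1 t.+1 o s2
  | bigstep_while1 c r b s1 t1 o1 s2 t2 o2 s3 t3 o3 s4 : r < size s2.1 ->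
      bigstep c s1 t1 o1 s2 -> reg s2 r <> 0 -> bigstep b s2 t2 o2 s3 ->
      bigstep (While c r b) s3 t3 o3 s4 ->
      bigstep (While c r b) s1 (t1 + t2 + t3).+2 (o1 ++ o2 ++ o3) s4.

Definition good (N : nat) (m : seq nat) : Prop :=
  exists rg h, [/\ m = rg ++ h, size rg = N, all (fun v => v <= B) rg & G h].

Definition sgood (N : nat) (s : state) : Prop :=
  [/\ size s.1 = N, all (fun v => v <= B) s.1 & G s.2].

(** The last configuration is left out of the trace, so that traces concatenate without
    repetition. *)
Inductive steps (P : program) N : config -> seq config -> seq nat -> config -> Prop :=
  | steps0 c : steps P N c [::] [::] c
  | stepsS c c1 o1 tr o c2 : good N (cells c) -> step P c = Some (c1, o1) ->
      steps P N c1 tr o c2 -> steps P N c (c :: tr) (o1 ++ o) c2.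

Lemma steps_cat P N c1 tr1 o1 c2 tr2 o2 c3 :
  steps P N c1 tr1 o1 c2 -> steps P N c2 tr2 o2 c3 ->
  steps P N c1 (tr1 ++ tr2) (o1 ++ o2) c3.
Proof.
move=> st1; elim: st1 tr2 o2 c3 => {c1 tr1 o1 c2} // c c1 o1 tr o c2 g e _ IH tr2 o2 c3 st2.
by rewrite -catA /=; apply: stepsS g e _; apply: IH.
Qed.

Lemma steps_good P N c tr o c' : steps P N c tr o c' ->
  forall c0, List.In c0 tr -> good N (cells c0).
Proof.
by elim=> {c tr o c'} // c c1 o1 tr o c2 g e _ IH c0 [<-|/IH].
Qed.

Lemma steps_exec P N c tr o c' : steps P N c tr o c' -> step P c' = None ->
  exec P c (rcons tr c') o.
Proof.
elim=> {c tr o c'} [c|c c1 o1 tr o c2 _ e _ IH] H; first exact: exec_halt.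
by apply: exec_step e _; apply: IH.
Qed.

Definition at_pc (P : program) n code :=
  exists P1 P2, P = P1 ++ code ++ P2 /\ size P1 = n.

Lemma at_pc_cat P n s1 s2 : at_pc P n (s1 ++ s2) ->
  at_pc P n s1 /\ at_pc P (n + size s1) s2.
Proof.
move=> [P1 [P2 [-> <-]]]; split.
  by exists P1, (s2 ++ P2); rewrite -catA.
by exists (P1 ++ s1), P2; rewrite size_cat -!catA.
Qed.

Lemma at_pc_cons P n i s : at_pc P n (i :: s) ->
  nth IHalt P n = i /\ at_pc P n.+1 s.
Proof.
rewrite -cat1s => /at_pc_cat[[P1 [P2 [-> <-]]] H2]; rewrite -addn1; split=> //.
by rewrite nth_cat ltnn subnn.
Qed.

Lemma good_state N s : sgood N s -> good N (s.1 ++ s.2).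
Proof. by case=> *; exists s.1, s.2. Qed.

Lemma nth_regs (rg h : seq nat) i : i < size rg -> nth 0 (rg ++ h) i = nth 0 rg i.
Proof. by rewrite nth_cat => ->. Qed.

Lemma nth_heap (rg h : seq nat) i : nth 0 (rg ++ h) (size rg + i) = nth 0 h i.
Proof. by rewrite nth_cat ltnNge leq_addr /= addKn. Qed.

Lemma set_regs (rg h : seq nat) i v : i < size rg ->
  set_nth 0 (rg ++ h) i v = set_nth 0 rg i v ++ h.
Proof. by elim: rg i => // a rg IH [|i] //= ?; rewrite IH. Qed.

Lemma set_heap (rg h : seq nat) i v :
  set_nth 0 (rg ++ h) (size rg + i) v = rg ++ set_nth 0 h i v.
Proof. by elim: rg => //= a rg ->. Qed.

Lemma size_set_regs (rg : seq nat) d v : d < size rg -> size (set_nth 0 rg d v) = size rg.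
Proof. by rewrite size_set_nth; lia. Qed.

Lemma all_set_nth (rg : seq nat) d v : d < size rg -> v <= B ->
  all (fun v => v <= B) rg -> all (fun v => v <= B) (set_nth 0 rg d v).
Proof.
by elim: rg d => // a rg IH [|d] //= lt_d le_v /andP[la lr]; rewrite ?le_v ?la //= IH.
Qed.

Lemma bigstep_sgood N c s t o s' : bigstep c s t o s' -> sgood N s -> sgood N s'.
Proof.
elim=> {c s t o s'} //; try by [auto | tauto].
- move=> rg h d v lt_d le_v [/= sz al g]; split => //=; first by rewrite size_set_regs.
  exact: all_set_nth.
- move=> rg h o d a b lt_d _ _ le_v [/= sz al g]; split => //=; first by rewrite size_set_regs.
  exact: all_set_nth.
- move=> rg h d a i lt_d _ _ le_v [/= sz al g]; split => //=; first by rewrite size_set_regs.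
  exact: all_set_nth.
- by move=> rg h a s i _ _ _ g [].
Qed.

Lemma steps1 P N c c' o : good N (cells c) -> step P c = Some (c', o) ->
  steps P N c [:: c] o c'.
Proof. by move=> g e; rewrite -[o]cats0; apply: stepsS g e _; apply: steps0. Qed.

(** Induction on the run rather than on the command: the remaining rounds of a loop are a shorter
    run of the same code at the same address. *)
Lemma compile_correct P N c s t o s' : bigstep c s t o s' -> sgood N s ->
  forall n, at_pc P n (compile c n) ->
  exists tr, size tr = t /\
    steps P N (Config n (s.1 ++ s.2)) tr o
              (Config (n + size (compile c n)) (s'.1 ++ s'.2)).
Proof.
elim=> {c s t o s'} /=.
- move=> rg h d v lt_d le_v gs n /at_pc_cons[e _].
  exists [:: Config n (rg ++ h)]; split=> //; apply: steps1; first exact: good_state gs.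
  by rewrite /step /= e /wr set_regs // addn1.
- move=> rg h o d a b lt_d lt_a lt_b le_v gs n /at_pc_cons[e _].
  exists [:: Config n (rg ++ h)]; split=> //; apply: steps1; first exact: good_state gs.
  by rewrite /step /= e /wr /rd set_regs // !nth_regs // addn1.
- move=> rg h d a i lt_d lt_a ea le_v gs n /at_pc_cons[e _].
  exists [:: Config n (rg ++ h)]; split=> //; apply: steps1; first exact: good_state gs.
  by rewrite /step /= e /wr /rd set_regs // (nth_regs _ lt_a) ea nth_heap addn1.
- move=> rg h a s i lt_a lt_s ea gh gs n /at_pc_cons[e _].
  exists [:: Config n (rg ++ h)]; split=> //; apply: steps1; first exact: good_state gs.
  by rewrite /step /= e /wr /rd !nth_regs // ea set_heap addn1.
- move=> rg h r lt_r gs n /at_pc_cons[e _].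
  exists [:: Config n (rg ++ h)]; split=> //; apply: steps1; first exact: good_state gs.
  by rewrite /step /= e /rd !nth_regs // addn1.
- by move=> s gs n _; exists [::]; rewrite addn0; split=> //; apply: steps0.
- move=> c1 c2 s1 s2 s3 t1 t2 o1 o2 b1 IH1 b2 IH2 g1 n /at_pc_cat[p1 p2].
  have [tr1 [<- st1]] := IH1 g1 n p1.
  have [tr2 [<- st2]] := IH2 (bigstep_sgood b1 g1) _ p2.
  exists (tr1 ++ tr2); rewrite size_cat; split=> //.
  by rewrite size_cat addnA; apply: steps_cat st1 st2.
- move=> r c1 c2 s t o s' lt_r e0 b IH g n /at_pc_cons[e] /at_pc_cat[_] /at_pc_cons[_ p2].
  rewrite addSn in p2; have [tr [<- st]] := IH g _ p2.
  exists (Config n (s.1 ++ s.2) :: tr); split=> //.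
  rewrite -[o]cat0s; apply: (@stepsS _ _ _ (Config (n + size (compile c1 n.+1)).+2 (s.1 ++ s.2))).
  + exact: good_state.
  + by rewrite /step /= e /rd nth_regs // [nth _ _ _]e0.
  + rewrite size_cat /=.
    have -> : n + (size (compile c1 n.+1) + (size (compile c2 (n + size (compile c1 n.+1)).+2)).+1).+1
      = (n + size (compile c1 n.+1)).+2 + size (compile c2 (n + size (compile c1 n.+1)).+2) by lia.
    exact: st.
- move=> r c1 c2 s t o s' lt_r e0 b IH g n /at_pc_cons[e] /at_pc_cat[p1] /at_pc_cons[ej _].
  have [tr [<- st]] := IH g _ p1.
  exists (Config n (s.1 ++ s.2) :: rcons tr (Config (n.+1 + size (compile c1 n.+1)) (s'.1 ++ s'.2))).
  split; first by rewrite /= size_rcons.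
  rewrite -[o]cat0s; apply: (@stepsS _ _ _ (Config n.+1 (s.1 ++ s.2))).
  + exact: good_state.
  + by rewrite /step /= e /rd nth_regs //; case: eqP => // /e0.
  + rewrite -cats1 -[o]cats0; apply: steps_cat st _; apply: steps1.
      exact: good_state (bigstep_sgood b g).
    by rewrite /step /= ej size_cat /=; congr (Some (Config _ _, _)); lia.
- move=> c r b s1 t o s2 lt_r b1 IH e0 g n /at_pc_cat[p1] /at_pc_cons[e _].
  have [tr [<- st]] := IH g _ p1.
  exists (rcons tr (Config (n + size (compile c n)) (s2.1 ++ s2.2))).
  split; first by rewrite size_rcons.
  rewrite -cats1 -[o]cats0; apply: steps_cat st _; apply: steps1.
    exact: good_state (bigstep_sgood b1 g).
  rewrite /step /= e /rd nth_regs // [nth _ _ _]e0 eqxx !size_cat /= size_cat /=.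
  by congr (Some (Config _ _, _)); lia.
- move=> c r b s1 t1 o1 s2 t2 o2 s3 t3 o3 s4 lt_r b1 IH1 e0 b2 IH2 b3 IH3 g n p.
  have [p1 /at_pc_cons[e /at_pc_cat[p2 /at_pc_cons[ej _]]]] := at_pc_cat p.
  have [tr1 [<- st1]] := IH1 g _ p1.
  have g2 := bigstep_sgood b1 g.
  have [tr2 [<- st2]] := IH2 g2 _ p2.
  have g3 := bigstep_sgood b2 g2.
  have [tr3 [<- st3]] := IH3 g3 _ p.
  exists (tr1 ++ [:: Config (n + size (compile c n)) (s2.1 ++ s2.2)] ++ tr2 ++
     [:: Config ((n + size (compile c n)).+1 + size (compile b (n + size (compile c n)).+1))
        (s3.1 ++ s3.2)] ++ tr3); split.
    by rewrite !size_cat /=; lia.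
  apply: (steps_cat st1); rewrite -[o2 ++ o3]cat0s; apply: (steps_cat (c2 := Config (n + size (compile c n)).+1 (s2.1 ++ s2.2))).
    apply: steps1; first exact: good_state.
    by rewrite /step /= e /rd nth_regs //; case: eqP => // /e0.
  apply: (steps_cat st2); rewrite -[o3]cat0s; apply: steps_cat st3.
  apply: steps1; first exact: good_state.
  by rewrite /step /= ej.
Qed.

(** A total-correctness triple. [T] is only an upper bound, so costs may be rounded up, while the
    output [o] is exact. Commands are chained by taking a triple as the postcondition of another. *)
Definition tr (c : cmd) (s : state) (T : nat) (o : seq nat) (Q : state -> Prop) : Prop :=
  exists t s', [/\ bigstep c s t o s', t <= T & Q s'].

Lemma tr_post c s T o (Q Q' : state -> Prop) :
  tr c s T o Q -> (forall s', Q s' -> Q' s') -> tr c s T o Q'.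
Proof. by move=> [t [s' [b le_t q]]] H; exists t, s'; split; auto. Qed.

Lemma tr_time c s T T' o Q : tr c s T o Q -> T <= T' -> tr c s T' o Q.
Proof. by move=> [t [s' [b le_t q]]] H; exists t, s'; split=> //; apply: leq_trans H. Qed.

Lemma tr_skip s Q : Q s -> tr Skip s 0 [::] Q.
Proof. by exists 0, s; split=> //; apply: bigstep_skip. Qed.

Lemma tr_seq c1 c2 s T1 T2 o1 o2 Q :
  tr c1 s T1 o1 (fun s1 => tr c2 s1 T2 o2 Q) ->
  tr (c1 ;; c2) s (T1 + T2) (o1 ++ o2) Q.
Proof.
move=> [t1 [s1 [b1 l1 [t2 [s2 [b2 l2 q]]]]]]; exists (t1 + t2), s2.
by split=> //; [apply: bigstep_seq b1 b2 | apply: leq_add].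
Qed.

Lemma tr_seq0 c1 c2 s T1 T2 o Q :
  tr c1 s T1 [::] (fun s1 => tr c2 s1 T2 o Q) ->
  tr (c1 ;; c2) s (T1 + T2) o Q.
Proof. exact: tr_seq. Qed.

Lemma tr_prim (i : instr) c s s' T oi o Q :
  bigstep i s 1 oi s' -> tr c s' T o Q -> tr (i ;; c) s T.+1 (oi ++ o) Q.
Proof.
move=> b [t [s2 [b2 l2 q]]]; exists (1 + t), s2; split=> //.
exact: bigstep_seq b b2.
Qed.

Lemma tr_const rg h d v c T o Q : d < size rg -> v <= B ->
  tr c (set_nth 0 rg d v, h) T o Q -> tr (IConst d v ;; c) (rg, h) T.+1 o Q.
Proof. by move=> ? ?; apply: (tr_prim (oi := [::])); apply: bigstep_const. Qed.

Lemma tr_op rg h f d a b c T o Q : d < size rg -> a < size rg -> b < size rg ->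
  eval_binop f (nth 0 rg a) (nth 0 rg b) <= B ->
  tr c (set_nth 0 rg d (eval_binop f (nth 0 rg a) (nth 0 rg b)), h) T o Q ->
  tr (IOp f d a b ;; c) (rg, h) T.+1 o Q.
Proof. by move=> ? ? ? ?; apply: (tr_prim (oi := [::])); apply: bigstep_op. Qed.

Lemma tr_load rg h d a i c T o Q : d < size rg -> a < size rg ->
  nth 0 rg a = size rg + i -> nth 0 h i <= B ->
  tr c (set_nth 0 rg d (nth 0 h i), h) T o Q ->
  tr (ILoad d a ;; c) (rg, h) T.+1 o Q.
Proof. by move=> ? ? ? ?; apply: (tr_prim (oi := [::])); apply: bigstep_load. Qed.

Lemma tr_store rg h a s i c T o Q : a < size rg -> s < size rg ->
  nth 0 rg a = size rg + i -> G (set_nth 0 h i (nth 0 rg s)) ->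
  tr c (rg, set_nth 0 h i (nth 0 rg s)) T o Q ->
  tr (IStore a s ;; c) (rg, h) T.+1 o Q.
Proof. by move=> ? ? ? ?; apply: (tr_prim (oi := [::])); apply: bigstep_store. Qed.

Lemma tr_out rg h r c T o Q : r < size rg -> tr c (rg, h) T o Q ->
  tr (IOut r ;; c) (rg, h) T.+1 (nth 0 rg r :: o) Q.
Proof. by move=> ?; apply: (tr_prim (oi := [:: _])); apply: bigstep_out. Qed.

Lemma tr_if r c1 c2 s T o Q : r < size s.1 ->
  (reg s r <> 0 -> tr c1 s T o Q) -> (reg s r = 0 -> tr c2 s T o Q) ->
  tr (If r c1 c2) s T.+2 o Q.
Proof.
move=> lt_r H1 H0; case: (reg s r =P 0) => [e|ne].
  have [t [s' [b l q]]] := H0 e; exists t.+1, s'; split=> //; last by lia.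
  exact: bigstep_if0.
have [t [s' [b l q]]] := H1 ne; exists t.+2, s'; split=> //.
exact: bigstep_if1.
Qed.

Lemma tr_while_end c r b s T Q :
  tr c s T [::] (fun s1 => [/\ r < size s1.1, reg s1 r = 0 & Q s1]) ->
  tr (While c r b) s T.+1 [::] Q.
Proof.
move=> [t [s1 [b1 l1 [lt_r e q]]]]; exists t.+1, s1; split=> //.
exact: bigstep_while0 b1 e.
Qed.

Lemma tr_while_step c r b s T1 T2 T3 o1 o2 Q :
  tr c s T1 [::] (fun s1 => [/\ r < size s1.1, reg s1 r <> 0 &
    tr b s1 T2 o1 (fun s2 => tr (While c r b) s2 T3 o2 Q)]) ->
  tr (While c r b) s (T1 + T2 + T3).+2 (o1 ++ o2) Q.
Proof.
move=> [t1 [s1 [b1 l1 [lt_r e [t2 [s2 [b2 l2 [t3 [s3 [b3 l3 q]]]]]]]]]].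
exists (t1 + t2 + t3).+2, s3; split=> //; last by lia.
exact: (bigstep_while1 lt_r b1 e b2 b3).
Qed.

(** [I i] describes the state before the guard is evaluated for round [i]; after [I n] the guard
    fails. A round costs guard, body and two jumps, the exit one guard and one jump. *)
Lemma tr_for c r b (n T : nat) (I : nat -> state -> Prop) (F : nat -> nat)
    (O : nat -> seq nat) (Q : state -> Prop) s :
  (forall i s, i < n -> I i s -> tr c s T [::] (fun s1 =>
     [/\ r < size s1.1, reg s1 r <> 0 & tr b s1 (F i) (O i) (I i.+1)])) ->
  (forall s, I n s -> tr c s T [::] (fun s1 =>
     [/\ r < size s1.1, reg s1 r = 0 & Q s1])) ->
  I 0 s ->
  tr (While c r b) s (\sum_(0 <= i < n) (T + F i).+2 + T.+1)
     (flatten [seq O i | i <- iota 0 n]) Q.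
Proof.
move=> Hs He.
suff H d : forall i s, i + d = n -> I i s ->
    tr (While c r b) s (\sum_(i <= j < n) (T + F j).+2 + T.+1)
     (flatten [seq O i | i <- iota i d]) Q.
  by apply: H; rewrite add0n.
elim: d => [|d IH] i s0; first rewrite addn0 => -> Is.
  by rewrite big_geq //=; apply: tr_while_end; apply: He.
move=> eid Is; have lt_i : i < n by lia.
rewrite big_ltn //= -addnA addSn addSn; apply: tr_while_step.
apply: tr_post (Hs _ _ lt_i Is) _ => s1 [lr e tb]; split=> //.
by apply: tr_post tb _ => s2 I2; apply: IH => //; lia.
Qed.

End Semantics.

(** * Estimates on primes *)

Definition primes_below (b : nat) : seq nat := [seq p <- iota 0 b | prime p].

Lemma primes_belowS b :
  primes_below b.+1 = primes_below b ++ (if prime b then [:: b] else [::]).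
Proof. by rewrite /primes_below -addn1 iotaD filter_cat. Qed.

Lemma mem_primes_below b p : (p \in primes_below b) = prime p && (p < b).
Proof. by rewrite mem_filter mem_iota. Qed.

Lemma sorted_primes_below b : sorted ltn (primes_below b).
Proof. by apply: sorted_filter (iota_ltn_sorted _ _); apply: ltn_trans. Qed.

Lemma primes_below_uniq b : uniq (primes_below b).
Proof. by rewrite filter_uniq // iota_uniq. Qed.

Lemma dvdn_prod_primes (s : seq nat) n :
  uniq s -> all prime s -> all (fun p => p %| n) s -> \prod_(p <- s) p %| n.
Proof.
elim: s n => [|p s IH] n /=; first by rewrite big_nil dvd1n.
move=> /andP[ps us] /andP[pp ap] /andP[pn an]; rewrite big_cons.
rewrite Gauss_dvd ?pn ?IH //.
elim: s ps us ap {IH an} => [|q s IH] /=; first by rewrite big_nil coprimen1.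
rewrite inE big_cons negb_or => /andP[npq ps] /andP[_ us] /andP[pq ap].
by rewrite coprimeMr IH // andbT prime_coprime // dvdn_prime2.
Qed.

(** It is one term of the expansion of [(1 + 1) ^ n.*2]. *)
Lemma bin_double_le n : 'C(n.*2, n) <= 4 ^ n.
Proof.
have le_n : n <= n.*2 by lia.
have -> : 4 ^ n = (1 + 1) ^ n.*2 by rewrite -mul2n expnM.
rewrite expnDn (bigD1 (inord n)) //= inordK; last by lia.
by rewrite !exp1n !muln1 leq_addr.
Qed.

(* The primes between 2^j and 2^(j+1) all divide binomial (2^(j+1)) (2^j). *)
Lemma primorial_le j : \prod_(p <- primes_below (2 ^ j).+1) p <= 4 ^ (2 ^ j).
Proof.
elim: j => [|j IH]; first by rewrite /primes_below /= unlock.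
rewrite /primes_below expnS mul2n -addnn -addSn iotaD filter_cat big_cat /=.
rewrite expnD; apply: leq_mul => //.
apply: leq_trans (bin_double_le (2 ^ j)); apply: dvdn_leq.
  by rewrite bin_gt0; lia.
apply: dvdn_prod_primes; first by rewrite filter_uniq // iota_uniq.
  by apply/allP => p; rewrite mem_filter => /andP[].
apply/allP => p; rewrite mem_filter mem_iota => /andP[pp /andP[lo hi]].
have e := @bin_fact (2 ^ j).*2 (2 ^ j) ltac:(lia).
have : p %| (2 ^ j).*2 `! by apply: dvdn_fact; rewrite prime_gt0 //; lia.
(* Being larger than [2 ^ j], the prime divides neither factorial of the denominator, so it divides
   the binomial coefficient. *)
have nf m : m < p -> p %| m`! = false.
  move=> lt_m; elim: m lt_m => [|m IHm] lt_m.
    by rewrite fact0 dvdn1; apply/eqP=> e1; rewrite e1 in pp.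
  by rewrite factS Euclid_dvdM // IHm ?gtnNdvd //; lia.
rewrite -e !Euclid_dvdM //.
have -> : (2 ^ j).*2 - 2 ^ j = 2 ^ j by lia.
by rewrite nf ?orbF //; lia.
Qed.

Lemma leq_prod_exp (s : seq nat) m : all (leq m) s -> m ^ size s <= \prod_(p <- s) p.
Proof.
elim: s => [|p s IH] /=; first by rewrite big_nil.
by move=> /andP[le_p /IH]; rewrite big_cons expnS => ?; apply: leq_mul.
Qed.

Lemma sqr_le_exp2 k : k * k <= 2 ^ k.+1.
Proof.
case: k => [|[|[|k]]] //; elim: k => // k IH.
by rewrite expnS; lia.
Qed.

(* Each of the primes in [2^(k/2), 2^k) contributes at least k/2 bits to the
   primorial; those below 2^(k/2) are few. *)
Lemma size_primes_below k : k * size (primes_below (2 ^ k)) <= 16 * 2 ^ k.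
Proof.
have -> : k * size (primes_below (2 ^ k)) = (k./2).*2 * size (primes_below (2 ^ k))
   + odd k * size (primes_below (2 ^ k)) by rewrite -mulnDl -{1}(odd_double_half k) addnC.
have szb b : size (primes_below b) <= b.
  by rewrite size_filter; apply: leq_trans (count_size _ _) _; rewrite size_iota.
set m := k./2; have le_m : m <= k by rewrite /m; lia.
have /subnKC e2 : 2 ^ m <= 2 ^ k by rewrite leq_exp2l.
have -> : size (primes_below (2 ^ k)) = size (primes_below (2 ^ m)) +
    size [seq p <- iota (2 ^ m) (2 ^ k - 2 ^ m) | prime p].
  by rewrite -{1}e2 /primes_below iotaD filter_cat size_cat.
set s := [seq p <- _ | _].
have le_s : size s <= 2 ^ k.
  by rewrite size_filter; apply: leq_trans (count_size _ _) _; rewrite size_iota; lia.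
have ms : m * size s <= 2 * 2 ^ k.
  have : (2 ^ m) ^ size s <= 4 ^ 2 ^ k.
    apply: leq_trans (leq_trans (leq_prod_exp _) _) (primorial_le k).
      by apply/allP=> p; rewrite mem_filter mem_iota => /andP[_ /andP[]].
    have -> : (2 ^ k).+1 = 2 ^ m + ((2 ^ k - 2 ^ m) + 1) by lia.
    rewrite /primes_below !iotaD !filter_cat !big_cat /= -/(primes_below _).
    have pos r : 0 < \prod_(p <- [seq p <- r | prime p]) p.
      by rewrite big_filter prodn_cond_gt0 // => i /prime_gt0.
    by rewrite mulnCA leq_pmulr // muln_gt0 (pos (iota 0 (2 ^ m))) (pos [:: _]).
  have -> : 4 ^ 2 ^ k = 2 ^ (2 * 2 ^ k) by rewrite expnM.
  by rewrite -expnM leq_exp2l.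
have sm : m * size (primes_below (2 ^ m)) <= 2 ^ k.+1.
  apply: leq_trans (leq_mul (leqnn m) (szb _)) _.
  have lm : m <= 2 ^ m by apply/ltnW/ltn_expl.
  apply: leq_trans (leq_mul lm (leqnn _)) _.
  by rewrite -expnD leq_exp2l // /m; lia.
have szm := szb (2 ^ m).
rewrite expnS in sm.
rewrite -[m.*2]mul2n; case: (odd k) => /=; lia.
Qed.

(** * Total number of prime factors of the integers up to x *)

Definition Omega (n : nat) : nat := \sum_(p <- primes n) logn p n.

Lemma Omega_primes_below n b : 0 < n -> n < b ->
  Omega n = \sum_(p <- primes_below b) logn p n.
Proof.
move=> n0 lt_n; rewrite /Omega.
have <- : [seq p <- primes_below b | p %| n] = primes n.
  apply: (irr_sorted_eq ltn_trans ltnn).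
  - by apply: sorted_filter (sorted_primes_below _); apply: ltn_trans.
  - exact: sorted_primes.
  - move=> p; rewrite mem_filter mem_primes_below mem_primes n0 /=.
    case: (boolP (prime p)) => pp; rewrite ?andbF // andTb /=.
    by case: (boolP (p %| n)) => //= /(dvdn_leq n0) ?; apply: leq_ltn_trans lt_n.
rewrite big_filter [RHS](bigID (fun p => p %| n)) /=.
rewrite [X in _ + X]big1_seq ?addn0 // => p /andP[ndv].
rewrite mem_primes_below => /andP[pp _].
by apply/eqP; rewrite -leqn0 leqNgt logn_gt0 mem_primes pp n0.
Qed.

(** After exchanging the sums, the exponents of a fixed prime add up to its exponent in the
    factorial, to which Legendre's formula applies. *)
Lemma sum_Omega x : \sum_(1 <= n < x.+1) Omega n = \sum_(p <- primes_below x.+1) logn p x`!.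
Proof.
rewrite big_nat (eq_bigr (fun n => \sum_(p <- primes_below x.+1) logn p n)); last first.
  by move=> n /andP[n0 lt_n]; apply: Omega_primes_below.
rewrite -big_nat exchange_big; apply: eq_bigr => p _.
elim: x => [|x IH]; first by rewrite big_geq // fact0 logn1.
by rewrite big_nat_recr //= IH factS mulnC lognM // fact_gt0.
Qed.

Lemma sum_geom x m : 1 < m -> forall K, m * \sum_(1 <= i < K) x %/ m ^ i <= 2 * x.
Proof.
move=> m1 K.
(* The added term pays for the next summand: with [y = x %/ m ^ j] and [q = y %/ m], both [m * q]
   and [2 * q] are at most [y]. *)
suff H j : m * \sum_(1 <= i < j.+1) x %/ m ^ i + 2 * (x %/ m ^ j) <= 2 * x.
  case: K => [|K]; first by rewrite big_geq ?muln0.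
  by apply: leq_trans (H K); rewrite leq_addr.
elim: j => [|j IH]; first by rewrite big_geq // muln0 expn0 divn1.
rewrite big_nat_recr //= mulnDr; apply: leq_trans IH.
rewrite -addnA leq_add2l expnSr divnMA.
have := leq_trunc_div (x %/ m ^ j) m; move: (_ %/ m) => q le_q.
have : 2 * q <= q * m by rewrite mulnC leq_mul2l m1 orbT.
lia.
Qed.

(** Legendre's formula with the powers of [p] replaced by those of [m]; taking [m] a power of 2
    makes the bound uniform over a dyadic block of primes. *)
Lemma logn_fact_le p x m : prime p -> 1 < m -> m <= p -> m * logn p x`! <= 2 * x.
Proof.
move=> pp m1 le_mp; rewrite logn_fact //; apply: leq_trans (sum_geom x m1 x.+1).
rewrite leq_pmul2l ?(ltnW m1) //; apply: leq_sum => i _.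
case: i => [|i]; first by rewrite !expn0.
by apply: leq_div2l; rewrite ?leq_exp2r // expn_gt0 (ltnW m1).
Qed.

(** A prime of the block from [2^j] to [2^(j+1)] contributes at most [2x/2^j], and there are at most
    [16 * 2^(j+1)/(j+1)] of them. The block thus contributes at most [64x/(j+1)], hence at most
    [64x/2^i]. *)
Lemma logn_fact_dyadicS x i j : 2 ^ i <= j ->
  2 ^ i * \sum_(p <- primes_below (2 ^ j.+1)) logn p x`! <=
  2 ^ i * \sum_(p <- primes_below (2 ^ j)) logn p x`! + 64 * x.
Proof.
move=> le_j; have j0 : 0 < j by apply: leq_trans le_j; rewrite expn_gt0.
have e : primes_below (2 ^ j.+1) =
    primes_below (2 ^ j) ++ [seq p <- iota (2 ^ j) (2 ^ j) | prime p].
  by rewrite /primes_below expnS mul2n -addnn iotaD filter_cat.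
rewrite [in X in X <= _]e big_cat mulnDr leq_add2l /=.
set s := [seq p <- iota _ _ | _] in e *.
have H : 2 ^ j * (\sum_(p <- s) logn p x`!) <= 2 * x * size (primes_below (2 ^ j.+1)).
  rewrite big_distrr /=; apply: leq_trans (_ : \sum_(p <- s) 2 * x <= _).
    rewrite big_seq [X in _ <= X]big_seq; apply: leq_sum => p.
    rewrite mem_filter mem_iota => /andP[pp /andP[le_p _]].
    by apply: logn_fact_le => //; rewrite -{1}(expn0 2) ltn_exp2l.
  by rewrite big_const_seq iter_addn_0 count_predT e size_cat leq_mul2l leq_addl orbT.
have P := size_primes_below j.+1.
suff : 2 ^ j * (2 ^ i * (\sum_(p <- s) logn p x`!)) <= 2 ^ j * (64 * x).
  by rewrite leq_pmul2l // expn_gt0.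
apply: leq_trans (_ : j * (2 ^ j * (\sum_(p <- s) logn p x`!)) <= _).
  by rewrite mulnCA leq_mul2r le_j orbT.
apply: leq_trans (leq_mul (leqnn j) H) _.
rewrite mulnCA [X in _ <= X](_ : _ = (2 * x) * (16 * 2 ^ j.+1)); last by rewrite expnS; lia.
by rewrite leq_mul2l (leq_trans _ P) ?orbT // leq_mul2r leqnSn orbT.
Qed.

(** A Mertens-type upper bound: passing from [i] to [i+1] adds [2^i] dyadic blocks, each
    contributing at most [64x/2^i]. *)
Lemma logn_fact_dyadic x i :
  \sum_(p <- primes_below (2 ^ (2 ^ i))) logn p x`! <= 64 * x * i.
Proof.
elim: i => [|i IH]; first by rewrite /primes_below /= unlock.
suff H d : 2 ^ i * \sum_(p <- primes_below (2 ^ (2 ^ i + d))) logn p x`! <=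
    2 ^ i * \sum_(p <- primes_below (2 ^ (2 ^ i))) logn p x`! + d * (64 * x).
  have := H (2 ^ i); rewrite -mulnDr addnn -mul2n -expnS leq_pmul2l ?expn_gt0 //.
  by move/leq_trans; apply; lia.
elim: d => [|d IHd]; first by rewrite addn0 leq_addr.
rewrite addnS; apply: leq_trans (logn_fact_dyadicS _ (leq_addr d _)) _.
by lia.
Qed.

Lemma sum_Omega_le x l : x < 2 ^ (2 ^ l) -> \sum_(1 <= n < x.+1) Omega n <= 64 * x * l.
Proof.
move=> lt_x; rewrite sum_Omega; apply: leq_trans (logn_fact_dyadic x l).
have -> : 2 ^ (2 ^ l) = x.+1 + (2 ^ (2 ^ l) - x.+1) by lia.
by rewrite /primes_below iotaD filter_cat big_cat leq_addr.
Qed.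

Lemma sum_logn_le_Omega n b : 0 < n -> \sum_(p <- primes_below b) logn p n <= Omega n.
Proof.
move=> n0; rewrite (@Omega_primes_below n (b + n.+1)) //; last by lia.
by rewrite /primes_below iotaD filter_cat big_cat leq_addr.
Qed.

Lemma sum_dvd_le_Omega n b : 0 < n -> \sum_(p <- primes_below b) (p %| n) <= Omega n.
Proof.
move=> n0; apply: leq_trans (sum_logn_le_Omega b n0).
rewrite big_seq [X in _ <= X]big_seq; apply: leq_sum => p.
rewrite mem_primes_below => /andP[pp _]; case: (boolP (p %| n)) => // dv.
by rewrite logn_gt0 mem_primes pp n0.
Qed.

Lemma logn_divout q m p : prime q -> 0 < m ->
  logn p (m %/ q ^ logn q m) = if p == q then 0 else logn p m.
Proof.
move=> pq m0; rewrite logn_div ?pfactor_dvdnn // lognX (logn_prime p pq).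
by case: (eqVneq p q) => [->|_]; rewrite ?muln1 ?subnn ?muln0 ?subn0.
Qed.

(* If n < r^2 has its prime factors below r removed, what remains is 1 or a
   prime, since two prime factors >= r would exceed n. *)
Lemma primes_cofactor r n m (s := [seq p <- primes_below r | p %| n]) :
  0 < n -> n < r * r -> 0 < m -> m %| n ->
  (forall q, prime q -> logn q m = if q \in s then 0 else logn q n) ->
  primes n = if m == 1 then s else rcons s m.
Proof.
move=> n0 lt_n m0 dm Hm.
have mem_s q : (q \in s) = [&& prime q, q < r & q %| n].
  by rewrite mem_filter mem_primes_below andbC -andbA.
have ge_r q : prime q -> q %| m -> r <= q.
  move=> pq dq; have : 0 < logn q m by rewrite logn_gt0 mem_primes pq m0.
  rewrite Hm //; case: ifP => // /negbT; rewrite mem_s pq (dvdn_trans dq dm) andbT /=.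
  by rewrite -leqNgt.
have dvd_m q : prime q -> q %| n -> q \notin s -> q %| m.
  move=> pq dq /negPf nq; have : 0 < logn q m by rewrite Hm // nq logn_gt0 mem_primes pq n0.
  by rewrite logn_gt0 mem_primes => /and3P[].
have so : sorted ltn s by apply: sorted_filter (sorted_primes_below r); apply: ltn_trans.
case: eqP => [m1|nm1].
  apply: (irr_sorted_eq ltn_trans ltnn (sorted_primes n) so) => q.
  rewrite mem_primes n0 /=; apply/idP/idP => [/andP[pq dq]|]; last first.
    by rewrite mem_s => /and3P[-> _ ->].
  apply/negPn/negP => /(dvd_m _ pq dq); rewrite m1 dvdn1 => /eqP e1.
  by rewrite e1 in pq.
have m1 : 1 < m by lia.
have pm : prime m.
  have pp := pdiv_prime m1; have := pdiv_dvd m; move: (pdiv m) pp => q pq /dvdnP[d ed].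
  have ge_q : r <= q by apply: ge_r => //; rewrite ed dvdn_mull.
  case: (ltngtP d 1) => d1; [|have pd := pdiv_prime d1|by rewrite ed d1 mul1n].
    by move: m0; rewrite ed; case: d d1 {ed} => //; rewrite mul0n.
  have ge_d : r <= pdiv d by apply: ge_r => //; rewrite ed; apply/dvdn_mulr/pdiv_dvd.
  have : r * r <= m by rewrite ed; apply: leq_mul => //; apply: leq_trans ge_d (pdiv_leq _); lia.
  by have := dvdn_leq n0 dm; lia.
apply: (irr_sorted_eq ltn_trans ltnn (sorted_primes n)).
  have : all (fun q => q < m) s.
    by apply/allP=> q; rewrite mem_s => /and3P[_ lt_q _]; apply: leq_trans lt_q (ge_r _ pm _).
  case: (s) so => //= y t so /andP[lt_y lt_t]; rewrite rcons_path so /=.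
  by have := mem_last y t; rewrite inE => /orP[/eqP->//|/(allP lt_t)].
move=> q; rewrite mem_primes n0 /= mem_rcons inE mem_s.
have [->|nq] := eqVneq q m; first by rewrite pm dm.
rewrite /=; case: (boolP (prime q)) => //= pq; apply/idP/idP => [dq|/andP[]//].
rewrite dq andbT; apply/negPn/negP => ge_q.
have := dvd_m _ pq dq; rewrite mem_s (negPf ge_q) andbF /= => /(_ isT).
by rewrite dvdn_prime2 // (negPf nq).
Qed.

(** The loops over a row run from its last entry down; this makes their total cost independent of
    the order. *)
Lemma sum_nth_rev (v : seq nat) (f : nat -> nat) :
  \sum_(0 <= j < size v) f (nth 0 v (size v - j.+1)) = \sum_(p <- v) f p.
Proof. by rewrite [RHS](big_nth 0) [RHS]big_nat_rev; apply: eq_bigr => j _; rewrite add0n. Qed.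

(** * The heap *)

Definition upd T (f : nat -> T) (o : nat) (v : T) : nat -> T :=
  fun i => if i == o then v else f i.

Lemma row_index w o j o' j' : j < w -> j' < w ->
  o * w + j = o' * w + j' -> o = o' /\ j = j'.
Proof.
move=> lt_j lt_j' e; have w0 : 0 < w by lia.
have : (o * w + j) %/ w = (o' * w + j') %/ w by rewrite e.
by rewrite !divnMDl // !divn_small // !addn0 => eo; split=> //; lia.
Qed.

Lemma row_lt L w o j : o < L -> j < w -> o * w + j < L * w.
Proof. by move=> lt_o lt_j; apply: (@leq_trans (o.+1 * w)); [lia | rewrite leq_mul2r lt_o orbT]. Qed.

(* The heap consists of L rows of w cells, row o holding cn o followed by s o,
   and then of the list g. *)
Definition hinv (L w : nat) (h : seq nat) (cn : nat -> nat) (s : nat -> seq nat)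
    (g : seq nat) : Prop :=
  [/\ forall o j, o < L -> j < w -> nth 0 h (o * w + j) = nth 0 (cn o :: s o) j,
      forall i, nth 0 h (L * w + i) = nth 0 g i
    & size h <= L * w + size g].

Section Heap.
Variables (L w : nat).
Implicit Types (h g : seq nat) (cn : nat -> nat) (s : nat -> seq nat).

(** Unwritten cells read as 0, and the heap is allowed to be shorter than its layout. *)
Lemma hinv_nil : hinv L w [::] (fun=> 0) (fun=> [::]) [::].
Proof. by split=> [o j _ _|i|//]; rewrite !nth_nil //; case: j => //= j; rewrite nth_nil. Qed.

Lemma hinv_ext h cn s g cn' s' : hinv L w h cn s g ->
  (forall o, o < L -> cn' o = cn o) -> (forall o, o < L -> s' o = s o) ->
  hinv L w h cn' s' g.
Proof. by move=> [H1 H2 H3] e1 e2; split=> // o j lo lj; rewrite e1 ?e2 // H1. Qed.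

(** The new row is described cell by cell, so that one lemma covers changing the count, appending an
    entry and deleting the last one. *)
Lemma hinv_row h cn s g cn' s' o j v : hinv L w h cn s g -> o < L -> j < w ->
  (forall o', o' != o -> cn' o' = cn o' /\ s' o' = s o') ->
  (forall j', j' < w ->
     nth 0 (cn' o :: s' o) j' = if j' == j then v else nth 0 (cn o :: s o) j') ->
  hinv L w (set_nth 0 h (o * w + j) v) cn' s' g.
Proof.
move=> [H1 H2 H3] lt_o lt_j eo ej; split.
- move=> o' j' lo lj; rewrite nth_set_nth /=.
  have [e|ne] := eqVneq o' o.
    by rewrite e eqn_add2l ej // -H1.
  have -> : (o' * w + j' == o * w + j) = false.
    by apply/eqP => /(row_index lj lt_j)[e _]; rewrite e eqxx in ne.
  by have [-> ->] := eo _ ne; rewrite H1.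
- move=> i; rewrite nth_set_nth /=.
  by have := row_lt lt_o lt_j; case: eqP => [|_ _]; [lia | exact: H2].
- by rewrite size_set_nth; have := row_lt lt_o lt_j; lia.
Qed.

Lemma hinv_count h cn s g o v : hinv L w h cn s g -> o < L -> 0 < w ->
  hinv L w (set_nth 0 h (o * w) v) (upd cn o v) s g.
Proof.
move=> H lo w0; rewrite -[o * w]addn0; apply: hinv_row H lo w0 _ _.
  by move=> o' /negPf ne; rewrite /upd ne.
by case=> [|j] _; rewrite /upd eqxx.
Qed.

Lemma hinv_push h cn s g o v : hinv L w h cn s g -> o < L -> (size (s o)).+1 < w ->
  hinv L w (set_nth 0 h (o * w + (size (s o)).+1) v) cn (upd s o (rcons (s o) v)) g.
Proof.
move=> H lo lw; apply: hinv_row H lo lw _ _.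
  by move=> o' /negPf ne; rewrite /upd ne.
case=> [|j] _ //=; rewrite /upd eqxx nth_rcons eqSS.
by case: ltngtP => // lt_j; rewrite nth_default // ltnW.
Qed.

(** Writing 0 deletes the last entry because 0 is also what [nth] returns beyond the end of a
    list. *)
Lemma hinv_pop h cn s g o t p : hinv L w h cn s g -> o < L -> (size t).+1 < w ->
  s o = rcons t p ->
  hinv L w (set_nth 0 h (o * w + (size t).+1) 0) cn (upd s o t) g.
Proof.
move=> H lo lw es; apply: hinv_row H lo lw _ _.
  by move=> o' /negPf ne; rewrite /upd ne.
case=> [|j] _ //=; rewrite /upd eqxx es nth_rcons eqSS.
by case: ltngtP => // lt_j; rewrite nth_default // ?lt_j // ltnW.
Qed.

Lemma hinv_gap h cn s g v : hinv L w h cn s g ->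
  hinv L w (set_nth 0 h (L * w + size g) v) cn s (rcons g v).
Proof.
move=> [H1 H2 H3]; split.
- move=> o j lo lj; rewrite nth_set_nth /=.
  by have := row_lt lo lj; case: eqP => [|_ _]; [lia | exact: H1].
- move=> i; rewrite nth_set_nth /= eqn_add2l nth_rcons.
  by case: ltngtP => [lt|gt|//]; rewrite H2 // nth_default // ltnW.
- by rewrite size_set_nth size_rcons; lia.
Qed.

End Heap.

(** * Bits taken by rows and gaps *)

Lemma bitlen_gt0 v : 0 < v -> bitlen v = (trunc_log 2 v).+1.
Proof. by case: v. Qed.

Lemma exp2_bitlen v : 0 < v -> 2 ^ (bitlen v) <= 2 * v.
Proof. by move=> v0; rewrite bitlen_gt0 // expnS leq_mul2l trunc_logP. Qed.

Lemma bitlen_le v m : v < 2 ^ m -> bitlen v <= m.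
Proof.
case: v => // v lt_v; rewrite bitlen_gt0 // -(ltn_exp2l _ _ (isT : 1 < 2)).
exact: leq_ltn_trans (trunc_logP _ _) lt_v.
Qed.

Lemma bitlen_leq v : bitlen v <= v.
Proof. exact/bitlen_le/ltn_expl. Qed.

(* Writing g = q 2^l + s, the quotient q needs at most q bits. *)
Lemma bitlen_gap g l : bitlen g <= l + g %/ 2 ^ l.
Proof.
apply: bitlen_le; rewrite expnD mulnC -ltn_divLR ?expn_gt0 //.
exact: ltn_expl.
Qed.

Lemma sum_divn_le (g : seq nat) m : \sum_(v <- g) v %/ m <= (\sum_(v <- g) v) %/ m.
Proof.
elim: g => [|v g IH]; first by rewrite !big_nil.
case: (posnP m) => [->|m0]; first by rewrite divn0 big1 // => v' _; rewrite divn0.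
by rewrite !big_cons divnD // -addnA leq_add2l (leq_trans IH) ?leq_addr.
Qed.

Lemma sum_bitlen_gaps (g : seq nat) l :
  \sum_(v <- g) bitlen v <= size g * l + (\sum_(v <- g) v) %/ 2 ^ l.
Proof.
apply: leq_trans (_ : \sum_(v <- g) (l + v %/ 2 ^ l) <= _).
  by apply: leq_sum => v _; apply: bitlen_gap.
by rewrite big_split /= leq_add ?sum_divn_le // big_const_seq iter_addn_0 count_predT mulnC.
Qed.

(** For [p >= 2] one has [2 ^ bitlen p <= 2 * p <= p ^ 2], so 2 to the power of the sum is at most
    the square of the product, which is below [4^(2k) = 2^(4k)]. *)
Lemma sum_bitlen_row (s : seq nat) x k : all (leq 2) s -> \prod_(p <- s) p <= x ->
  x < 4 ^ k -> \sum_(p <- s) bitlen p <= 4 * k.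
Proof.
move=> s2 le_x lt_x; rewrite -(leq_exp2l _ _ (isT : 1 < 2)).
apply: leq_trans (_ : (\prod_(p <- s) p) ^ 2 <= _).
  elim: s s2 {le_x} => [|p s IH] /=; first by rewrite !big_nil.
  move=> /andP[p2 /IH {}IH]; rewrite !big_cons expnD expnMn leq_mul //.
  apply: leq_trans (exp2_bitlen _) _; first by lia.
  by rewrite leq_mul2r p2 orbT.
apply: leq_trans (_ : (4 ^ k) ^ 2 <= _); first by rewrite leq_exp2r //; lia.
by rewrite -expnM -[4 in X in X <= _]/(2 ^ 2) -expnM leq_exp2l //; lia.
Qed.

Lemma size_row (s : seq nat) x k : all (leq 2) s -> \prod_(p <- s) p <= x ->
  x < 4 ^ k -> size s < 2 * k.
Proof.
move=> s2 le_x lt_x; rewrite -(ltn_exp2l _ _ (isT : 1 < 2)).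
apply: leq_ltn_trans (leq_prod_exp s2) _; rewrite expnM.
exact: leq_ltn_trans le_x lt_x.
Qed.

Lemma spaceE m : space m = size m + \sum_(v <- m) bitlen v.
Proof.
rewrite /space; elim: m => [|v m IH] /=; first by rewrite big_nil.
by rewrite big_cons IH; lia.
Qed.

Lemma sum_nth_le (t : seq nat) n : \sum_(0 <= j < n) bitlen (nth 0 t j) <= \sum_(v <- t) bitlen v.
Proof.
elim: t n => [|v t IH] n; first by rewrite big_nil big1 // => i _; rewrite nth_nil.
case: n => [|n]; first by rewrite big_geq.
by rewrite big_nat_recl // big_cons leq_add2l; apply: IH.
Qed.

(** Cells of a row beyond its entries hold 0, of bit length 0, and cost only the one bit per cell
    that [space] charges; this is the term [L * w]. *)
Lemma hinv_space L w h cn s g b : hinv L w h cn s g ->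
  (forall o, o < L -> bitlen (cn o) + \sum_(p <- s o) bitlen p <= b) ->
  space h <= L * w + size g + (L * b + \sum_(v <- g) bitlen v).
Proof.
move=> [H1 H2 H3] Hb; rewrite spaceE leq_add //.
apply: leq_trans (_ : \sum_(0 <= i < L * w + size g) bitlen (nth 0 h i) <= _).
  rewrite (big_nth 0) (@big_cat_nat _ _ _ (size h) 0 (L * w + size g)) //=.
  exact: leq_addr.
rewrite (@big_cat_nat _ _ _ (L * w)) ?leq_addr //= leq_add //.
  suff H n : n <= L -> \sum_(0 <= i < n * w) bitlen (nth 0 h i) <= n * b by apply: H.
  elim: n => [|n IH] lt_n; first by rewrite big_geq.
  rewrite (@big_cat_nat _ _ _ (n * w)) ?leq_mul2r ?leqnSn ?orbT //= [n.+1 * b]mulSnr.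
  apply: leq_add; first exact/IH/ltnW.
  rewrite mulSnr -{1}[n * w]add0n big_addn addKn.
  apply: leq_trans (Hb _ lt_n); apply: leq_trans (_ : \sum_(0 <= j < w) bitlen (nth 0 (cn n :: s n) j) <= _).
    by rewrite big_nat [X in _ <= X]big_nat; apply: leq_sum => j /andP[_ lt_j]; rewrite addnC H1.
  by apply: leq_trans (sum_nth_le _ _) _; rewrite big_cons.
rewrite -{1}[L * w]add0n big_addn addKn; apply: leq_trans (sum_nth_le g (size g)).
by apply: leq_sum => i _; rewrite addnC H2.
Qed.

(** Starting from 0 makes the first gap the first prime, so the primes are the partial sums. *)
Definition gaps (ps : seq nat) := pairmap (fun a b => b - a) 0 ps.

Lemma size_gaps ps : size (gaps ps) = size ps.
Proof. exact: size_pairmap. Qed.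

Lemma gaps_rcons ps p : gaps (rcons ps p) = rcons (gaps ps) (p - last 0 ps).
Proof. by rewrite -!cats1 /gaps pairmap_cat. Qed.

Lemma sum_gaps ps : sorted leq ps -> \sum_(v <- gaps ps) v = last 0 ps.
Proof.
elim/last_ind: ps => [|ps p IH]; first by rewrite /gaps /= big_nil.
move=> so; have /IH {}IH : sorted leq ps.
  by move: so; rewrite -cats1 => /(subseq_sorted leq_trans (prefix_subseq _ _)).
rewrite gaps_rcons -cats1 big_cat /= big_seq1 IH last_rcons subnKC //.
case/lastP: ps so {IH} => // ps q so; rewrite last_rcons.
have := so; rewrite -!cats1 -catA /= => /(subseq_sorted leq_trans (suffix_subseq _ _)) /=.
by rewrite andbT.
Qed.

(** * The sieve *)

(* Registers.  The names follow the variables of the specifications below; vone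
   holds 1, vbase the address of the heap, vgb that of the gaps, and vt, vu are
   scratch registers. *)
Local Notation vx := 0 (only parsing).
Local Notation vone := 1 (only parsing).
Local Notation vbase := 2 (only parsing).
Local Notation vr := 3 (only parsing).
Local Notation vk := 4 (only parsing).
Local Notation vl := 5 (only parsing).
Local Notation vL := 6 (only parsing).
Local Notation vw := 7 (only parsing).
Local Notation vgb := 8 (only parsing).
Local Notation vcnt := 9 (only parsing).
Local Notation va := 10 (only parsing).
Local Notation vlen := 11 (only parsing).
Local Notation vi := 12 (only parsing).
Local Notation vp := 13 (only parsing).
Local Notation vo := 14 (only parsing).
Local Notation vc := 15 (only parsing).
Local Notation vn := 16 (only parsing).
Local Notation vm := 17 (only parsing).
Local Notation ve := 18 (only parsing).
Local Notation vt := 19 (only parsing).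
Local Notation vu := 20 (only parsing).
Local Notation nregs := 21 (only parsing).

(** No logarithm is computed: [r] is doubled while [r * r <= x], and [l] is raised while
    [2 ^ l <= k]. The registers [vk] and [vl] rely on being 0 initially. *)
Definition init_code : cmd :=
  IConst vone 1 ;; IConst vbase nregs ;; IConst vr 1 ;;
  While (IOp OMul vt vr vr ;; IOp OAdd vu vx vone ;; IOp OSub vt vu vt ;; Skip) vt
    (IOp OAdd vr vr vr ;; IOp OAdd vk vk vone ;; Skip) ;;
  While (IOp OShl vt vone vl ;; IOp OAdd vu vk vone ;; IOp OSub vt vu vt ;; Skip) vt
    (IOp OAdd vl vl vone ;; Skip) ;;
  IOp OMul vL vk vl ;; IOp ODiv vL vr vL ;; IOp OAdd vL vL vone ;;
  IOp OAdd vw vk vk ;;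
  IOp OMul vgb vL vw ;; IOp OAdd vgb vgb vbase ;; Skip.

(** The inner loop stops at [pdiv n], which equals [n] exactly for a prime. [vp] keeps the last
    prime found, from which the gap is measured. *)
Definition trial_code : cmd :=
  IConst ve 2 ;;
  While (IOp OMod vt vn ve ;; Skip) vt (IOp OAdd ve ve vone ;; Skip) ;;
  IOp OSub vt vn ve ;;
  If vt Skip
    (IOp OSub vt vn vp ;; IOp OAdd vu vgb vcnt ;; IStore vu vt ;;
     IOp OAdd vcnt vcnt vone ;; IOp OMul vp vn vone ;; Skip) ;;
  IOp OAdd vn vn vone ;; Skip.

Definition primes_code : cmd :=
  IConst vn 2 ;; While (IOp OSub vt vr vn ;; Skip) vt trial_code ;; Skip.

Definition visit_code : cmd :=
  IOp OMul vu vo vw ;; IOp OAdd vu vu vbase ;; ILoad vc vu ;; IOp OAdd vc vc vone ;;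
  IStore vu vc ;; IOp OAdd vu vu vc ;; IStore vu vp ;; IOp OAdd vo vo vp ;; Skip.

(** The starting offset is [a] rounded up to a multiple of [p], minus [a]. *)
Definition sieve_prime_code : cmd :=
  IOp OAdd vu vgb vi ;; ILoad vt vu ;; IOp OAdd vp vp vt ;;
  IOp OAdd vo va vp ;; IOp OSub vo vo vone ;; IOp ODiv vo vo vp ;; IOp OMul vo vo vp ;;
  IOp OSub vo vo va ;;
  While (IOp OSub vt vlen vo ;; Skip) vt visit_code ;;
  IOp OAdd vi vi vone ;; Skip.

Definition sieve_code : cmd :=
  IConst vp 0 ;; IConst vi 0 ;;
  While (IOp OSub vt vcnt vi ;; Skip) vt sieve_prime_code ;; Skip.

Definition divout_code : cmd :=
  While (IOp OMod vt vm vp ;; IOp OSub vt vone vt ;; Skip) vt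
    (IOp ODiv vm vm vp ;; IOp OAdd ve ve vone ;; Skip).

(** A cofactor other than 1 is appended to the row, so that the output loop treats it like any other
    prime. *)
Definition cofactor_code : cmd :=
  IOp OMul vi vc vone ;; IOp OMul vm vn vone ;;
  While Skip vi
    (IOp OAdd vt vu vi ;; ILoad vp vt ;; IConst ve 0 ;; divout_code ;;
     IOp OSub vi vi vone ;; Skip) ;;
  IOp OSub vt vm vone ;;
  If vt (IOp OAdd vc vc vone ;; IOp OAdd vt vu vc ;; IStore vt vm ;; Skip) Skip ;;
  Skip.

(** Exponents are not stored but recomputed from [n]. Each entry is overwritten by 0 once read:
    stale primes would escape the bound on the product of a row in later segments. *)
Definition emit_code : cmd :=
  While Skip vc
    (IOp OAdd vt vu vc ;; ILoad vp vt ;; IConst ve 0 ;; IStore vt ve ;;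
     IOp OMul vm vn vone ;; divout_code ;; IOut vp ;; IOut ve ;;
     IOp OSub vc vc vone ;; Skip).

Definition output_one_code : cmd :=
  IOp OMul vu vo vw ;; IOp OAdd vu vu vbase ;; ILoad vc vu ;; IOp OAdd vn va vo ;;
  cofactor_code ;; IOut vn ;; IOut vc ;; emit_code ;; IStore vu vc ;;
  IOp OAdd vo vo vone ;; Skip.

Definition output_code : cmd :=
  IConst vo 0 ;; While (IOp OSub vt vlen vo ;; Skip) vt output_one_code ;; Skip.

(** On entry [vt] holds [x + 1 - a], left there by the guard of the outer loop; [L - (L - t)] is the
    minimum of [L] and [t], so the last segment may be shorter. *)
Definition segment_code : cmd :=
  IOp OSub vu vL vt ;; IOp OSub vlen vL vu ;;
  sieve_code ;; output_code ;; IOp OAdd va va vL ;; Skip.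

Definition sieve_program : cmd :=
  init_code ;; primes_code ;; IConst va 1 ;;
  While (IOp OAdd vt vx vone ;; IOp OSub vt vt va ;; Skip) vt segment_code ;; Skip.

(** Count and entries are bounded separately, without [cn o = size (s o)]: a visit raises the count
    before it writes the entry, and the heap must be acceptable in between. *)
Definition rows_ok (L k x : nat) (cn : nat -> nat) (s : nat -> seq nat) : Prop :=
  forall o, o < L -> [/\ cn o <= k + k, all (leq 2) (s o) & \prod_(p <- s o) p <= x].

(** The bound [b] is existential because the list of gaps is still growing while the primes are
    being found. *)
Definition heap_ok (L k x r : nat) (h : seq nat) : Prop :=
  exists cn s b, [/\ hinv L (k + k) h cn s (gaps (primes_below b)),
                     rows_ok L k x cn s & b <= r].

Lemma rows_ok_nil L k x : 0 < x -> rows_ok L k x (fun=> 0) (fun=> [::]).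
Proof. by move=> x0 o _; rewrite big_nil. Qed.

Lemma flatten_nils (T : Type) (n : nat) :
  flatten [seq [::] | _ <- iota 0 n] = [::] :> seq T.
Proof. by elim: (iota 0 n). Qed.

Local Ltac op := eapply tr_op; [by []|by []|by []| |]; rewrite /=; [try lia|].
Local Ltac cst := eapply tr_const; [by []|try lia|rewrite /=].
Local Ltac ld i := apply: (@tr_load _ _ _ _ _ _ i); [by []|by []| | |]; rewrite /=; [try lia| |].
Local Ltac str i := apply: (@tr_store _ _ _ _ _ _ i); [by []|by []| | |]; rewrite /=; [try lia| |].

Section For.
Variables (B : nat) (G : seq nat -> Prop).
Lemma tr_for0 c r b (n T : nat) (I : nat -> state -> Prop) (F : nat -> nat)
    (Q : state -> Prop) s :
  (forall i s, i < n -> I i s -> tr B G c s T [::] (fun s1 =>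
     [/\ r < size s1.1, reg s1 r <> 0 & tr B G b s1 (F i) [::] (I i.+1)])) ->
  (forall s, I n s -> tr B G c s T [::] (fun s1 =>
     [/\ r < size s1.1, reg s1 r = 0 & Q s1])) ->
  I 0 s ->
  tr B G (While c r b) s (\sum_(0 <= i < n) (T + F i).+2 + T.+1) [::] Q.
Proof.
move=> H1 H2 H3; have := tr_for (F := F) (O := fun=> [::]) H1 H2 H3.
by rewrite flatten_nils.
Qed.

Lemma tr_forc c r b (n T F : nat) (I : nat -> state -> Prop) (Q : state -> Prop) s :
  (forall i s, i < n -> I i s -> tr B G c s T [::] (fun s1 =>
     [/\ r < size s1.1, reg s1 r <> 0 & tr B G b s1 F [::] (I i.+1)])) ->
  (forall s, I n s -> tr B G c s T [::] (fun s1 =>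
     [/\ r < size s1.1, reg s1 r = 0 & Q s1])) ->
  I 0 s ->
  tr B G (While c r b) s (n * (T + F).+2 + T.+1) [::] Q.
Proof.
move=> H1 H2 H3; have := tr_for0 (F := fun=> F) H1 H2 H3.
by rewrite sum_nat_const_nat subn0.
Qed.
End For.

(** * Correctness and cost of the phases of the sieve *)

Section Phases.
Variables (x r k l L cnt B : nat).
Hypotheses (x3 : 3 <= x) (hB : 40 * x + 100 <= B) (r2 : 2 <= r) (r_le : r <= 2 * x)
  (r_sq : x < r * r) (k_le : k <= r) (k_hi : x < 4 ^ k) (L0 : 0 < L)
  (L_le : L <= 3 * x) (Lw_le : L * (k + k) <= 8 * x) (cnt_le : cnt <= r).

Let G := heap_ok L k x r.
Local Notation st cnt a len i p o c n m e t u := 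
  ([:: x; 1; 21; r; k; l; L; k + k; L * (k + k) + 21; cnt; a; len; i; p; o; c; n; m; e; t; u] : seq nat).
Local Notation tr := (tr B G).

Lemma divout_spec a len i p o c n m t u h : prime p -> 0 < m -> m <= x ->
  tr divout_code (st cnt a len i p o c n m 0 t u, h) (logn p m * 6 + 3) [::]
    (fun s' => exists t', s' = 
       (st cnt a len i p o c n (m %/ p ^ logn p m) (logn p m) t' u, h)).
Proof.
move=> pp m0 le_m; have p1 := prime_gt1 pp.
(* This keeps the exponent register below [B]. *)
have lt_l : logn p m < m.
  by apply: leq_trans (ltn_expl _ p1) _; apply: dvdn_leq => //; apply: pfactor_dvdnn.
have mod_le y z : y %% z <= y by apply: leq_mod.
have div_le y z : y %/ z <= y by apply: leq_div.
apply: (@tr_forc _ _ _ _ _ _ 2 2 (fun j s => exists t, s =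
   (st cnt a len i p o c n (m %/ p ^ j) j t u, h))).
- move=> j _ lt_j [t' ->]; have := div_le m (p ^ j).
  have : p %| m %/ p ^ j.
    by rewrite dvdn_divRL -?expnS pfactor_dvdn // ltnW.
  rewrite /dvdn; move: (m %/ p ^ j) (divnMA m (p ^ j) p) => y ey /eqP dv le_y.
  op.
  op; apply: tr_skip; split=> //=; first by rewrite /reg /= dv.
  op; first by have := div_le y p; lia.
  op; apply: tr_skip; eexists.
  by rewrite expnSr ey addn1.
- move=> _ [t' ->]; have := div_le m (p ^ logn p m).
  have : ~~ (p %| m %/ p ^ logn p m).
    by rewrite dvdn_divRL ?pfactor_dvdnn // -expnS pfactor_dvdn // ltnn.
  rewrite /dvdn; move: (m %/ _) => y ndv le_y.
  op; first by have := mod_le y p; lia.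
  op; apply: tr_skip; split=> //=; first by rewrite /reg /=; lia.
  by eexists.
- by exists t; rewrite divn1.
Qed.

Lemma heap_okI h cn s b : hinv L (k + k) h cn s (gaps (primes_below b)) ->
  rows_ok L k x cn s -> b <= r -> G h.
Proof. by move=> *; exists cn, s, b. Qed.

Lemma primes_spec h a len i o c m e t u : hinv L (k + k) h (fun=> 0) (fun=> [::]) [::] ->
  tr primes_code (st 0 a len i 0 o c 0 m e t u, h) (r * (4 * r + 20) + 10) [::]
  (fun s' => exists p n e t u h', s' = 
     (st (size (primes_below r)) a len i p o c n m e t u, h') /\
     hinv L (k + k) h' (fun=> 0) (fun=> [::]) (gaps (primes_below r))).
Proof.
clear cnt cnt_le; move=> Hh; have x0 : 0 < x by apply: leq_trans x3.
apply: (@tr_time _ _ _ _ (((r - 2) * (1 + (4 * r + 15)).+2 + 1.+1) + 0).+1).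
  cst.
  apply: tr_seq0.
  apply: tr_post; first apply: (@tr_forc _ _ _ _ _ (r - 2) 1 (4 * r + 15) (fun j s => exists e t u h', s =
     (st (size (primes_below (j + 2))) a len i (last 0 (primes_below (j + 2))) o c (j + 2) m e t u, h') /\
     hinv L (k + k) h' (fun=> 0) (fun=> [::]) (gaps (primes_below (j + 2))))
     (fun s' => exists p n e t u h', s' = 
     (st (size (primes_below r)) a len i p o c n m e t u, h') /\
     hinv L (k + k) h' (fun=> 0) (fun=> [::]) (gaps (primes_below r)))).
  - move=> j _ lt_j [e' [t' [u' [h' [-> Hh']]]]].
    op; apply: tr_skip; split=> //; first by rewrite /reg /=; lia.
    have : 2 <= j + 2 < r by lia.
    rewrite -[j.+1 + 2]/((j + 2).+1); move: (j + 2) Hh' => n Hh' /andP[n2 lt_n].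
    have sz : size (primes_below n) <= n.
      by rewrite size_filter; apply: leq_trans (count_size _ _) _; rewrite size_iota.
    have le_pd : pdiv n <= n by apply: pdiv_leq; lia.
    have pd2 : 1 < pdiv n by apply/prime_gt1/pdiv_prime.
    have pdp : prime n = (pdiv n == n).
      by apply/idP/eqP => [/pdiv_id//|<-]; apply: pdiv_prime.
    (* The failing trials [2, ..., pdiv n - 1] cost 4 steps each, and [pdiv n <= n < r]. *)
    apply: (@tr_time _ _ _ _ (((pdiv n - 2) * (1 + 1).+2 + 1.+1) + (5.+2 + 1).+1).+1); last by lia.
    cst.
    pose trial e t := (st (size (primes_below n)) a len i (last 0 (primes_below n)) o c n m e t u', h').
    apply: tr_seq0; apply: tr_post.
      apply: (@tr_forc _ _ _ _ _ (pdiv n - 2) 1 1 (fun d s => exists t, s = trial (d + 2) t)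
        (fun s' => exists t, s' = trial (pdiv n) t)); rewrite /trial.
    + move=> d _ lt_d [t2 ->]; have le_m := leq_mod n (d + 2).
      op; apply: tr_skip; split=> //=.
        rewrite /reg /= => /eqP nd; suff : pdiv n <= d + 2 by lia.
        by apply: pdiv_min_dvd => //; lia.
      op; apply: tr_skip; eexists; congr ([:: _; _; _; _; _; _; _; _; _; _; _; _; _; _; _; _; _; _; _; _; _], _).
      by lia.
    + move=> _ [t2 ->]; have le_m := leq_mod n (pdiv n - 2 + 2).
      op; apply: tr_skip; split=> //=.
        rewrite /reg /=; have -> : pdiv n - 2 + 2 = pdiv n by lia.
        by apply/eqP/pdiv_dvd.
      by eexists; have -> : pdiv n - 2 + 2 = pdiv n by lia.
    + by eexists.
    + move=> _ [t2 ->]; op.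
      apply: tr_seq0; apply: tr_if => //; rewrite /reg /= => ec.
        apply: (@tr_time _ _ _ _ 0) => //; apply: tr_skip.
        op; apply: tr_skip; rewrite primes_belowS pdp.
        have -> : (pdiv n == n) = false by apply/eqP; lia.
        by rewrite cats0; do 4!eexists; split; [rewrite addn1|].
      have ln : last 0 (primes_below n) <= n.
        have := mem_last 0 (primes_below n); rewrite inE => /orP[/eqP->//|].
        by rewrite mem_primes_below => /andP[_ /ltnW].
      have Hg := hinv_gap (n - last 0 (primes_below n)) Hh'.
      have eb : primes_below n.+1 = rcons (primes_below n) n.
        by rewrite primes_belowS pdp -cats1; case: eqP => // ne; lia.
      rewrite -gaps_rcons -eb size_gaps in Hg.
      op; op; str (L * (k + k) + size (primes_below n)).
        by apply: heap_okI Hg _ _ => //; apply: rows_ok_nil.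
      op; op; apply: tr_skip; op; apply: tr_skip.
      by do 4!eexists; split; last exact: Hg; rewrite eb size_rcons last_rcons muln1 !addn1.
  - move=> _ [e' [t' [u' [h' [-> Hh']]]]].
    have er : r - 2 + 2 = r by lia.
    rewrite er in Hh' *; op; apply: tr_skip; split=> //; first by rewrite /reg /=; lia.
    by do 6!eexists; split; last exact: Hh'.
  - by do 4!eexists; split; last exact: Hh.
  - move=> s' H; exact: tr_skip.
by nia.
Qed.

(** * Collecting the small prime divisors in the rows of a segment *)

Lemma prod_dvd_primes (s : seq nat) n : 0 < n -> n <= x -> uniq s -> all prime s ->
  all (fun p => p %| n) s ->
  [/\ all (leq 2) s, \prod_(p <- s) p <= x & size s < k + k].
Proof.
move=> n0 le_n us ps ds.
have s2 : all (leq 2) s by apply: sub_all ps => p /prime_gt1.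
have le_p : \prod_(p <- s) p <= x.
  by apply: leq_trans le_n; apply: dvdn_leq => //; apply: dvdn_prod_primes.
by split=> //; have := size_row s2 le_p k_hi; lia.
Qed.

Definition drow (qs : seq nat) n := [seq q <- qs | q %| n].

Lemma drow_facts qs n : 0 < n -> n <= x -> uniq qs -> all prime qs ->
  [/\ all (leq 2) (drow qs n), \prod_(p <- drow qs n) p <= x & size (drow qs n) < k + k].
Proof.
move=> n0 le_n us ps; apply: (@prod_dvd_primes _ n) => //; first exact: filter_uniq.
  by apply/allP=> q; rewrite mem_filter => /andP[_ /(allP ps)].
exact: filter_all.
Qed.

(* Rows of a segment starting at a while p is being sieved: the offsets below b
   have already been treated. *)
Definition srow a len qs p b o :=
  if o < len then drow (if o < b then rcons qs p else qs) (a + o) else [::].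

Lemma srow_facts a len qs p b o : 0 < a -> a + len <= x.+1 ->
  uniq (rcons qs p) -> all prime (rcons qs p) ->
  [/\ all (leq 2) (srow a len qs p b o), \prod_(q <- srow a len qs p b o) q <= x
    & size (srow a len qs p b o) < k + k].
Proof.
move=> a0 le_a uq pq; rewrite /srow; case: ifP => lt_o; last first.
  have k0 : 0 < k by case: (k) k_hi => //; lia.
  by rewrite big_nil; split=> //=; lia.
have /andP[_ uq'] : (p \notin qs) && uniq qs by rewrite -rcons_uniq.
have /andP[_ pq'] : prime p && all prime qs by rewrite -all_rcons.
by apply: drow_facts; try lia; case: ifP.
Qed.

Lemma rows_ok_srow a len qs p b cn : 0 < a -> a + len <= x.+1 ->
  uniq (rcons qs p) -> all prime (rcons qs p) ->
  (forall o, o < L -> cn o <= k + k) ->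
  rows_ok L k x cn (srow a len qs p b).
Proof. by move=> a0 le_a uq pq Hc o lt_o; have [] := srow_facts b o a0 le_a uq pq; split; auto. Qed.

(** Strictly between [o] and [o + p] there is no multiple of [p], so moving the frontier by [p]
    changes row [o] only. *)
Lemma srow_step a len qs p o o' : 0 < a -> o < len -> p %| a + o -> 
  srow a len qs p (o + p) o' =
  upd (srow a len qs p o) o (rcons (srow a len qs p o o) p) o'.
Proof.
move=> a0 lt_o dv; rewrite /upd /srow; case: eqP => [->|/eqP ne].
  by rewrite lt_o ltnn -[X in X < _]addn0 ltn_add2l; case: (posnP p) dv => [->|p0 dv];
    [rewrite dvd0n; lia | rewrite /drow filter_rcons dv].
case: ifP => // lt_o'; case: (ltnP o' o) => [lt|ge]; first by rewrite ltn_addr.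
case: ifP => // lt'; rewrite /drow filter_rcons ifN //.
have -> : a + o' = (a + o) + (o' - o) by lia.
by rewrite dvdn_addr // gtnNdvd //; lia.
Qed.

Let w := k + k.
Local Notation g := (gaps (primes_below r)).

(** The time is proportional to the number of multiples of [p] still ahead: one guard step, 8 body
    steps and two jumps for each. *)
Lemma visit_spec a len i p c n m e qs o t u h cn : 0 < a -> a + len <= x.+1 -> len <= L ->
  uniq (rcons qs p) -> all prime (rcons qs p) -> p < r -> p %| a + o -> o <= r + L ->
  hinv L w h cn (srow a len qs p o) g ->
  (forall o', o' < L -> cn o' = size (srow a len qs p o o')) ->
  tr (While (IOp OSub vt vlen vo ;; Skip) vt visit_code)
    (st cnt a len i p o c n m e t u, h) (11 * (\sum_(o <= j < len) (p %| a + j)) + 2) [::]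
  (fun s' => exists o c t u h' cn',
     [/\ s' = (st cnt a len i p o c n m e t u, h'),
         hinv L w h' cn' (srow a len qs p len) g &
         forall o', o' < L -> cn' o' = size (srow a len qs p len o')]).
Proof.
move=> a0 le_a le_len uq pq lt_p; have [d] := ubnP (len - o).
have pp : prime p by move: pq; rewrite all_rcons => /andP[].
have p0 := prime_gt0 pp.
elim: d o c t u h cn => // d IH o c t u h cn lt_d dv le_o Hh Hc.
have [ge_o|lt_o] := leqP len o.
  apply: (@tr_time _ _ _ _ 2); last by lia.
  apply: tr_while_end; op; apply: tr_skip; rewrite /reg /=; split=> //; first by lia.
  have es o' : o' < L -> srow a len qs p len o' = srow a len qs p o o'.
    by move=> _; rewrite /srow; case: (ltnP o' len) => // lt; rewrite (leq_trans lt).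
  exists o, c; do 4!eexists; split; first reflexivity.
    by apply: hinv_ext Hh _ _ => // o' lt'; rewrite es.
  by move=> o' lt'; rewrite Hc ?es.
have ltL : o < L by lia.
(* The size bound is applied to the row as it is after the visit, so it shows that there is room for
   the new entry. *)
have Hf := srow_facts (o + p) o a0 le_a uq pq.
have eo := srow_step qs o a0 lt_o dv; rewrite /upd eqxx in eo.
rewrite eo size_rcons in Hf; case: Hf => _ _ lt_w.
have Hr := rows_ok_srow _ a0 le_a uq pq.
have ow : o * (k + k) + (k + k) <= 8 * x.
  by apply: leq_trans Lw_le; rewrite -mulSnr leq_mul2r ltL orbT.
have ch : nth 0 h (o * (k + k)) = cn o.
  by case: Hh => H _ _; rewrite -[o * _]addn0 H // /w; lia.
have sz := Hc o ltL.
have Hc1 o' : o' < L -> cn o' <= k + k.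
  move=> lt'; rewrite Hc //.
  by have [_ _ /ltnW] := srow_facts o o' a0 le_a uq pq.
have w0 : 0 < w by rewrite /w; lia.
have H1 := hinv_count (cn o).+1 Hh ltL w0.
have H2 := hinv_push p H1 ltL; rewrite -sz in H2.
have {}H2 := H2 ltac:(rewrite /w; lia).
have Hc2 o' : o' < L -> upd cn o (cn o).+1 o' <= k + k.
  by rewrite /upd; case: eqP => [_ _|_ /Hc1//]; lia.
have H3 : hinv L w (set_nth 0 (set_nth 0 h (o * w) (cn o).+1) (o * w + (cn o).+1) p)
   (upd cn o (cn o).+1) (srow a len qs p (o + p)) g.
  by apply: hinv_ext H2 _ _ => // o' _; rewrite srow_step.
apply: (@tr_time _ _ _ _ (1 + 8 + (11 * (\sum_(o + p <= j < len) (p %| a + j)) + 2)).+2).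
  rewrite -[[::]]cat0s; apply: tr_while_step.
  op; apply: tr_skip; split=> //; first by rewrite /reg /=; lia.
  op; op; ld (o * (k + k)); rewrite ch; first by have := Hc1 _ ltL; lia.
  op; str (o * (k + k)); rewrite addn1.
    by apply: heap_okI H1 (Hr _ _ Hc2) (leqnn r).
  op; str (o * (k + k) + (cn o).+1).
    by apply: heap_okI H3 (Hr _ _ Hc2) (leqnn r).
  op; apply: tr_skip; apply: IH H3 _; [by lia| |by lia|].
    by rewrite addnA dvdn_addl.
  move=> o' lt'; rewrite srow_step // /upd; case: eqP => // _.
    by rewrite size_rcons sz.
  exact: Hc.
rewrite (big_ltn lt_o) dv.
(* The next offset visited is [o + p]; the terms before it are dropped. *)
have : \sum_(o + p <= j < len) (p %| a + j) <= \sum_(o.+1 <= j < len) (p %| a + j).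
  have [le|gt] := leqP (o + p) len; last by rewrite big_geq // ltnW.
  by rewrite [X in _ <= X](@big_cat_nat _ _ _ (o + p)) ?leq_addl //; lia.
lia.
Qed.

Lemma first_multiple a p : 0 < a -> 0 < p -> let q := (a + p - 1) %/ p in
  [/\ a <= q * p, q * p <= a + p - 1 & forall n, a <= n -> n < q * p -> ~~ (p %| n)].
Proof.
move=> a0 p0 q; have le_q : q * p <= a + p - 1 by apply: leq_trunc_div.
have lt_q : a + p - 1 < q.+1 * p by apply: ltn_ceil.
rewrite mulSn in lt_q; split=> //; first by lia.
move=> n le_n lt_n; apply/dvdnP=> -[m em]; have lt_m : m < q.
  by rewrite -(ltn_pmul2r p0) -em.
have : m.+1 * p <= q * p by rewrite leq_mul2r lt_m orbT.
by rewrite mulSn; lia.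
Qed.

Definition seg_row a len o := if o < len then drow (primes_below r) (a + o) else [::].

(** Every prime costs 14 steps even without a multiple in the segment, which is what forbids short
    segments. The visits correspond to pairs of a prime and a multiple; counted by the multiple,
    they are bounded by [Omega]. *)
Lemma sieve_spec a len i p o c n m e t u h cn : cnt = size (primes_below r) ->
  0 < a -> a + len <= x.+1 -> len <= L ->
  hinv L w h cn (fun=> [::]) g -> (forall o, o < L -> cn o = 0) ->
  tr sieve_code (st cnt a len i p o c n m e t u, h)
    (14 * cnt + 11 * (\sum_(0 <= j < len) Omega (a + j)) + 4) [::]
  (fun s' => exists i p o c t u h' cn',
     [/\ s' = (st cnt a len i p o c n m e t u, h'),
         hinv L w h' cn' (seg_row a len) g &
         forall o', o' < L -> cn' o' = size (seg_row a len o')]).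
Proof.
move=> ecnt a0 le_a le_len Hh Hc; set ps := primes_below r.
pose row i o := if o < len then drow (take i ps) (a + o) else [::].
pose F i := 11 * (\sum_(0 <= j < len) (nth 0 ps i %| a + j)) + 11.
apply: (@tr_time _ _ _ _ ((\sum_(0 <= i < cnt) (1 + F i).+2 + 1.+1) + 0).+2).
  cst; cst; apply: tr_seq0; apply: tr_post.
    (* Before round [i] the register [vp] holds the previous prime, or 0 when [i = 0]; this is
       [nth 0 (0 :: ps) i]. *)
    apply: (@tr_for0 _ _ _ _ _ cnt 1 (fun i s => exists o c t u h' cn',
     [/\ s = (st cnt a len i (nth 0 (0 :: ps) i) o c n m e t u, h'),
         hinv L w h' cn' (row i) g &
         forall o', o' < L -> cn' o' = size (row i o')]) F
     (fun s' => exists i p o c t u h' cn',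
     [/\ s' = (st cnt a len i p o c n m e t u, h'),
         hinv L w h' cn' (seg_row a len) g &
         forall o', o' < L -> cn' o' = size (seg_row a len o')])).
  - move=> {Hh Hc}{}i _ lt_i [o1 [c1 [t1 [u1 [h1 [cn1 [-> Hh Hc]]]]]]].
    op; apply: tr_skip; split=> //; first by rewrite /reg /=; lia.
    have lt_i' : i < size ps by rewrite /ps -ecnt.
    have := mem_nth 0 lt_i'; rewrite /F mem_primes_below.
    set q := nth 0 ps i => /andP[pq lt_q]; have q0 := prime_gt0 pq.
    have et : take i.+1 ps = rcons (take i ps) q by rewrite (take_nth 0).
    have uq : uniq (rcons (take i ps) q) by rewrite -et take_uniq // primes_below_uniq.
    have aq : all prime (rcons (take i ps) q).
      by rewrite -et; apply/allP=> z /mem_take; rewrite mem_primes_below => /andP[].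
    have gi : nth 0 h1 (L * w + i) = q - nth 0 (0 :: ps) i.
      by case: Hh => _ -> _; rewrite /gaps (nth_pairmap 0).
    have le_pi : nth 0 (0 :: ps) i <= q.
      rewrite /q; case: (i) lt_i' => //= j lt_j; apply/ltnW.
      by apply: (sorted_ltn_nth ltn_trans); rewrite ?inE ?sorted_primes_below // ltnW.
    have [le1 le2 nd] := first_multiple a0 q0.
    pose o0 := (a + q - 1) %/ q * q - a; have eo : a + o0 = (a + q - 1) %/ q * q by rewrite subnKC.
    apply: (@tr_time _ _ _ _ ((11 * (\sum_(o0 <= j < len) (q %| a + j)) + 2) + 1).+4.+4); last first.
      have : \sum_(o0 <= j < len) (q %| a + j) <= \sum_(0 <= j < len) (q %| a + j); last by lia.
      have [le|gt] := leqP o0 len; last by rewrite big_geq // ltnW.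
      by rewrite [X in _ <= X](@big_cat_nat _ _ _ o0) //= leq_addl.
    op; ld (L * (k + k) + i); rewrite gi; first by lia.
    op; op; op; rewrite subnKC //.
    have dq := leq_div (a + q - 1) q; op; op; op; rewrite -/o0.
    (* Offsets before the first multiple are not divisible by [q], so they count as already
       treated. *)
    have er o' : srow a len (take i ps) q o0 o' = row i o'.
      rewrite /row /srow; case: ifP => // lt_o'; case: ifP => // lt0.
      rewrite /drow filter_rcons ifN //; apply: nd; first exact: leq_addr.
      by rewrite -eo ltn_add2l.
    have el o' : srow a len (take i ps) q len o' = row i.+1 o'.
      by rewrite /row /srow et; case: (o' < len).
    apply: tr_seq0; apply: tr_post; first apply: (@visit_spec _ _ _ _ _ _ _ _ (take i ps) _ _ _ _ cn1) => //.
    + by rewrite eo dvdn_mull.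
    + by lia.
    + by apply: hinv_ext Hh _ _ => // o' _; rewrite er.
    + by move=> o' lt'; rewrite er Hc.
    move=> _ [o2 [c2 [t2 [u2 [h2 [cn2 [-> Hh2 Hc2]]]]]]].
    op; apply: tr_skip; exists o2, c2, t2, u2, h2, cn2; rewrite addn1; split=> //.
      by apply: hinv_ext Hh2 _ _ => // o' _; rewrite el.
    by move=> o' lt'; rewrite Hc2 ?el.
  - move=> _ [o1 [c1 [t1 [u1 [h1 [cn1 [-> Hh1 Hc1]]]]]]].
    op; apply: tr_skip; split=> //; first by rewrite /reg /=; lia.
    have er o' : seg_row a len o' = row cnt o' by rewrite /row ecnt take_size.
    do 8!eexists; split; first reflexivity.
      by apply: hinv_ext Hh1 _ _ => // o' _; rewrite er.
    by move=> o' lt'; rewrite Hc1 ?er.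
  - have e0 o' : row 0 o' = [::] by rewrite /row take0 /drow; case: ifP.
    do 6!eexists; split; first reflexivity.
      by apply: hinv_ext Hh _ _ => // o' _; rewrite e0.
    by move=> o' lt'; rewrite Hc ?e0.
  - by move=> s' H; exact: tr_skip.
have -> : \sum_(0 <= i < cnt) (1 + F i).+2 =
   11 * (\sum_(0 <= i < cnt) \sum_(0 <= j < len) (nth 0 ps i %| a + j)) + cnt * 14.
  rewrite big_distrr /= -[cnt in X in _ = _ + X]subn0 -sum_nat_const_nat -big_split /=.
  by apply: eq_bigr => j _; rewrite /F; lia.
have : \sum_(0 <= i < cnt) \sum_(0 <= j < len) (nth 0 ps i %| a + j) <= \sum_(0 <= j < len) Omega (a + j).
  rewrite exchange_big /=; apply: leq_sum => j _.
  apply: leq_trans (sum_dvd_le_Omega r _); last by lia.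
  by rewrite [X in _ <= X](big_nth 0) -/ps ecnt.
lia.
Qed.

(** * From rows to complete factorizations *)

Lemma row_read h cn s o j : hinv L w h cn s g -> o < L -> j < w ->
  nth 0 h (o * (k + k) + j) = nth 0 (cn o :: s o) j.
Proof. by case=> H _ _ lo lj; rewrite H. Qed.

Lemma row_bound o : o < L -> o * (k + k) + (k + k) <= 8 * x.
Proof. by move=> lo; apply: leq_trans Lw_le; rewrite -mulSnr leq_mul2r lo orbT. Qed.

Lemma rows_ok_upd cn s o v : rows_ok L k x cn s -> all (leq 2) v ->
  \prod_(p <- v) p <= x -> rows_ok L k x cn (upd s o v).
Proof. by move=> Hr v2 pv o' /Hr[c1 c2 c3]; rewrite /upd; case: eqP. Qed.

Lemma rows_ok_count cn s o c : rows_ok L k x cn s -> c <= k + k ->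
  rows_ok L k x (upd cn o c) s.
Proof. by move=> Hr le_c o' /Hr[c1 c2 c3]; split=> //; rewrite /upd; case: eqP. Qed.

Lemma upd_id T (f : nat -> T) o i : upd f o (f o) i = f i.
Proof. by rewrite /upd; case: eqP => // ->. Qed.

Lemma primes_facts n : 0 < n -> n <= x -> 
  [/\ all (leq 2) (primes n), \prod_(p <- primes n) p <= x & size (primes n) < k + k].
Proof.
move=> n0 le_n; apply: prod_dvd_primes le_n _ _ _ => //; first exact: primes_uniq.
  by apply/allP=> p; rewrite mem_primes => /and3P[].
by apply/allP=> p; rewrite mem_primes => /and3P[].
Qed.

Lemma cofactor_spec a len i p o n m e t u h cn S :
  0 < n -> n <= x -> o < L -> S o = drow (primes_below r) n -> u = o * (k + k) + 21 ->
  hinv L w h cn S g -> rows_ok L k x cn S ->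
  tr cofactor_code (st cnt a len i p o (size (S o)) n m e t u, h) (15 * Omega n + 10) [::]
  (fun s' => exists i p m e t h',
     s' = (st cnt a len i p o (size (primes n)) n m e t u, h') /\
     hinv L w h' cn (upd S o (primes n)) g).
Proof.
move=> n0 le_n lo eS -> Hh Hr; have lt_n : n < r * r := leq_ltn_trans le_n r_sq.
have ow := row_bound lo; set s := S o.
have [_ _ sz] : [/\ all (leq 2) s, \prod_(p <- s) p <= x & size s < k + k].
  rewrite /s eS; apply: drow_facts => //; first exact: primes_below_uniq.
  by apply/allP=> q; rewrite mem_primes_below => /andP[].
have us : uniq s by rewrite /s eS filter_uniq // primes_below_uniq.
have ms q : q \in s -> prime q /\ q %| n.
  by rewrite /s eS mem_filter mem_primes_below => /andP[-> /andP[-> _]].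
pose c := size s; rewrite -/c.
pose F j := logn (nth 0 s (c - j.+1)) n * 6 + 7.
apply: (@tr_time _ _ _ _ ((\sum_(0 <= j < c) (0 + F j).+2 + 0.+1) + (3.+2 + 0).+1).+2).
  op; op; apply: tr_seq0; apply: tr_post.
    (* The invariant gives [m] by its valuations, 0 at the primes already divided out and those of
       [n] elsewhere, which is the hypothesis of [primes_cofactor]. *)
    apply: (@tr_for0 _ _ _ _ _ c 0 (fun j s' => exists p m e t,
      [/\ s' = (st cnt a len (c - j) p o c n m e t (o * (k + k) + 21), h), 0 < m, m %| n &
       forall q, prime q -> logn q m = if q \in drop (c - j) s then 0 else logn q n]) F
     (fun s' => exists i p m e t,
      [/\ s' = (st cnt a len i p o c n m e t (o * (k + k) + 21), h), 0 < m, m %| n &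
       forall q, prime q -> logn q m = if q \in s then 0 else logn q n])).
  - move=> j _ lt_j [p1 [m1 [e1 [t1 [-> m0 dm Hm]]]]].
    apply: tr_skip; split=> //; first by rewrite /reg /=; lia.
    have lt_q : c - j.+1 < size s by rewrite -/c; lia.
    have [pq dq] := ms _ (mem_nth 0 lt_q).
    have ed := drop_nth 0 lt_q; move: pq dq ed; rewrite /F; set q := nth 0 s _ => pq dq ed.
    have ec : (c - j.+1).+1 = c - j by lia.
    rewrite ec in ed.
    have nq : q \notin drop (c - j) s.
      have : uniq (drop (c - j.+1) s) by apply: drop_uniq.
      by rewrite ed => /andP[].
    have lq : logn q m1 = logn q n by rewrite Hm // (negPf nq).
    have le_m : m1 <= n by apply: dvdn_leq.
    have q_le : q <= x by apply: leq_trans le_n; apply: dvdn_leq.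
    apply: (@tr_time _ _ _ _ ((logn q m1 * 6 + 3) + 1).+3); last by lia.
    have rq : nth 0 h (o * (k + k) + (c - j)) = q.
      by rewrite (row_read Hh lo) /w -?ec //=; lia.
    op; ld (o * (k + k) + (c - j)); rewrite rq; first by lia.
    cst; apply: tr_seq0; apply: tr_post; first apply: divout_spec => //; first by lia.
    move=> _ [t2 ->]; op; apply: tr_skip.
    do 4!eexists; split; first by congr ([:: _; _; _; _; _; _; _; _; _; _; _; _; _; _; _; _; _; _; _; _; _], _); lia.
    + by rewrite divn_gt0 ?expn_gt0 ?prime_gt0 // dvdn_leq // pfactor_dvdnn.
    + apply: dvdn_trans dm; apply/dvdnP; exists (q ^ logn q m1).
      by rewrite mulnC divnK // pfactor_dvdnn.
    + move=> q' pq'; rewrite logn_divout // ed inE; case: eqP => //= _.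
      by rewrite Hm.
  - move=> _ [p1 [m1 [e1 [t1 [-> m0 dm Hm]]]]].
    apply: tr_skip; split=> //; first by rewrite /reg /=; lia.
    do 5!eexists; split; [reflexivity|by []|by []|].
    by move=> q pq; rewrite Hm // subnn drop0.
  - exists p, n, e, t; split=> //; first by rewrite subn0 !muln1.
    by move=> q pq; rewrite subn0 drop_size.
  - move=> _ [i1 [p1 [m1 [e1 [t1 [-> m0 dm Hm]]]]]].
    have le_m : m1 <= n by apply: dvdn_leq.
    have ep : primes n = if m1 == 1 then s else rcons s m1.
      have es : s = [seq p <- primes_below r | p %| n] by rewrite /s eS.
      by rewrite es; apply: primes_cofactor => // q pq; rewrite -es; apply: Hm.
    have [P1 P2 P3] := primes_facts n0 le_n.
    op; apply: tr_seq0; apply: tr_if => //; rewrite /reg /= => em; last first.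
      apply: (@tr_time _ _ _ _ 0) => //; apply: tr_skip; apply: tr_skip.
      have em1 : m1 == 1 by lia.
      rewrite em1 in ep; do 6!eexists; split; first by rewrite ep.
      by apply: hinv_ext Hh _ _ => // o' _; rewrite ep upd_id.
    have ne1 : (m1 == 1) = false by lia.
    rewrite ne1 in ep; have H1 := hinv_push m1 Hh lo.
    (* The extended row is [primes n], whose size is below the row width, so the cofactor fits. *)
    rewrite -/s -ep in H1; rewrite ep size_rcons in P3.
    op; op; str (o * (k + k) + c.+1).
      apply: heap_okI (H1 P3) _ (leqnn r); apply: rows_ok_upd => //.
    apply: tr_skip; apply: tr_skip; do 6!eexists; split; last exact: H1.
    by rewrite ep size_rcons addn1.
have -> : \sum_(0 <= j < c) (0 + F j).+2 = \sum_(p <- s) (logn p n * 6 + 9).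
  rewrite -(sum_nth_rev s (fun p => logn p n * 6 + 9)).
  by apply: eq_bigr => j _; rewrite /F /c /=; lia.
(* Listed primes have exponent at least 1, which absorbs the constant 9. *)
have : \sum_(p <- s) (logn p n * 6 + 9) <= \sum_(p <- s) 15 * logn p n.
  rewrite big_seq [X in _ <= X]big_seq; apply: leq_sum => q /ms[pq dq].
  have : 0 < logn q n by rewrite logn_gt0 mem_primes pq n0.
  lia.
rewrite -big_distrr /=; have : \sum_(p <- s) logn p n <= Omega n; last by lia.
apply: leq_trans (sum_logn_le_Omega r n0); rewrite /s eS big_filter.
by rewrite [X in _ <= X](bigID (fun p => p %| n)) /= leq_addr.
Qed.

(** A row is emptied from its end, so the primes come out in decreasing order; hence [rev]. *)
Lemma emit_spec a len i p o n m e t u h cn S :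
  0 < n -> n <= x -> o < L -> S o = primes n -> u = o * (k + k) + 21 ->
  hinv L w h cn S g -> rows_ok L k x cn S ->
  tr emit_code (st cnt a len i p o (size (primes n)) n m e t u, h) (21 * Omega n + 1)
  (flatten [seq [:: pe.1; pe.2] | pe <- rev (prime_decomp n)])
  (fun s' => exists p m e t h',
     s' = (st cnt a len i p o 0 n m e t u, h') /\
     hinv L w h' cn (upd S o [::]) g).
Proof.
move=> n0 le_n lo eS -> Hh Hr; have lt_n : n < r * r := leq_ltn_trans le_n r_sq.
have ow := row_bound lo; set s := primes n; pose c := size s; rewrite -/c.
have [s2 sx sz] := primes_facts n0 le_n; rewrite -/s -/c in sz.
have ms q : q \in s -> prime q /\ q %| n by rewrite mem_primes => /and3P[].
pose F j := logn (nth 0 s (c - j.+1)) n * 6 + 11.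
pose O j := let q := nth 0 s (c - j.+1) in [:: q; logn q n].
have -> : flatten [seq [:: pe.1; pe.2] | pe <- rev (prime_decomp n)] =
    flatten [seq O j | j <- iota 0 c].
  congr flatten; rewrite prime_decompE -map_rev -map_comp -/s.
  apply: (@eq_from_nth _ [::]); rewrite !size_map size_rev ?size_iota // => j lt_j.
  rewrite (nth_map 0) ?size_rev // (nth_map 0) ?size_iota // nth_iota // add0n.
  by rewrite nth_rev.
apply: (@tr_time _ _ _ _ (\sum_(0 <= j < c) (0 + F j).+2 + 0.+1)).
  apply: (@tr_for _ _ _ _ _ c 0 (fun j s' => exists p m e t h', 
      s' = (st cnt a len i p o (c - j) n m e t (o * (k + k) + 21), h') /\
      hinv L w h' cn (upd S o (take (c - j) s)) g) F O).
  - move=> j _ lt_j [p1 [m1 [e1 [t1 [h1 [-> Hh1]]]]]].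
    apply: tr_skip; split=> //; first by rewrite /reg /=; lia.
    have lt_q : c - j.+1 < size s by rewrite -/c; lia.
    have [pq dq] := ms _ (mem_nth 0 lt_q).
    have ed := take_nth 0 lt_q; move: pq dq ed; rewrite /F /O; set q := nth 0 s _ => pq dq ed.
    have ec : (c - j.+1).+1 = c - j by lia.
    rewrite ec in ed.
    have q_le : q <= x by apply: leq_trans le_n; apply: dvdn_leq.
    have szt : size (take (c - j) s) = c - j by rewrite size_takel // -/c; lia.
    have szt' : size (take (c - j.+1) s) = c - j.+1 by rewrite size_takel // -/c; lia.
    have rq : nth 0 h1 (o * (k + k) + (c - j)) = q.
      rewrite (row_read Hh1 lo) /w; last by lia.
      by rewrite /upd eqxx ed -ec /= nth_rcons szt' ltnn eqxx.
    have Hl : upd S o (take (c - j) s) o = rcons (take (c - j.+1) s) q by rewrite /upd eqxx.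
    have H1 := hinv_pop Hh1 lo _ Hl; rewrite szt' ec in H1.
    have {}H1 := H1 ltac:(rewrite /w; lia).
    have lt_l : logn q n < n.
      by apply: leq_trans (ltn_expl _ (prime_gt1 pq)) _; apply: dvdn_leq => //; apply: pfactor_dvdnn.
    have H2 : hinv L w (set_nth 0 h1 (o * w + (c - j)) 0) cn (upd S o (take (c - j.+1) s)) g.
      by apply: hinv_ext H1 _ _ => // o' _; rewrite /upd; case: eqP.
    apply: (@tr_time _ _ _ _ ((logn q n * 6 + 3) + 3).+4.+1); last by lia.
    op; ld (o * (k + k) + (c - j)); rewrite rq; first by lia.
    cst; str (o * (k + k) + (c - j)).
      apply: heap_okI H2 _ (leqnn r); apply: rows_ok_upd => //.
        by apply/allP=> z /mem_take /(allP s2).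
      (* The entries already erased are positive, so the product of the remaining ones is no
         larger. *)
      apply: leq_trans sx; rewrite -[primes n](cat_take_drop (c - j.+1)) big_cat /=.
      rewrite leq_pmulr // big_seq; apply: prodn_cond_gt0 => z /mem_drop /(allP s2).
      exact: ltnW.
    op; apply: tr_seq0; rewrite muln1; apply: tr_post; first apply: divout_spec => //.
    move=> _ [t2 ->]; apply: tr_out => //; apply: tr_out => //=.
    op; apply: tr_skip; do 5!eexists; split; last exact: H2.
    by congr ([:: _; _; _; _; _; _; _; _; _; _; _; _; _; _; _; _; _; _; _; _; _], _); lia.
  - move=> _ [p1 [m1 [e1 [t1 [h1 [-> Hh1]]]]]].
    apply: tr_skip; split=> //; first by rewrite /reg /=; lia.
    do 5!eexists; split; first by rewrite subnn.
    by move: Hh1; rewrite subnn take0.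
  - do 5!eexists; split; first by rewrite subn0.
    by rewrite subn0 take_size; apply: hinv_ext Hh _ _ => // o' _; rewrite /s -eS upd_id.
have -> : \sum_(0 <= j < c) (0 + F j).+2 = \sum_(p <- s) (logn p n * 6 + 13).
  rewrite -(sum_nth_rev s (fun p => logn p n * 6 + 13)).
  by apply: eq_bigr => j _; rewrite /F /c /=; lia.
have : \sum_(p <- s) (logn p n * 6 + 13) <= \sum_(p <- s) 21 * logn p n.
  rewrite big_seq [X in _ <= X]big_seq; apply: leq_sum => q /ms[pq dq].
  have : 0 < logn q n by rewrite logn_gt0 mem_primes pq n0.
  lia.
by rewrite -big_distrr /= -/(Omega n); lia.
Qed.

Definition block n := fact_block n (rev (prime_decomp n)).

Lemma output_one_spec a len i p o c m n e t u h cn S :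
  0 < a -> a + len <= x.+1 -> len <= L -> o < len ->
  S o = drow (primes_below r) (a + o) -> cn o = size (S o) ->
  hinv L w h cn S g -> rows_ok L k x cn S ->
  tr output_one_code (st cnt a len i p o c n m e t u, h) (36 * Omega (a + o) + 20)
  (block (a + o))
  (fun s' => exists i p c n m e t u h',
     s' = (st cnt a len i p o.+1 c n m e t u, h') /\
     hinv L w h' (upd cn o 0) (upd S o [::]) g).
Proof.
move=> a0 le_a le_L lt_o eS ec Hh Hr; have lo : o < L by lia.
have ow := row_bound lo; have [c1 _ _] := Hr _ lo.
have k0 : 0 < k by case: (k) k_hi => //; lia.
have ch : nth 0 h (o * (k + k)) = size (S o).
  by rewrite -[o * _]addn0 (row_read Hh lo) //= /w; lia.
have n0 : 0 < a + o by lia.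
have le_n : a + o <= x by lia.
have [P1 P2 P3] := primes_facts n0 le_n.
have -> : block (a + o) = a + o :: size (primes (a + o)) ::
   flatten [seq [:: pe.1; pe.2] | pe <- rev (prime_decomp (a + o))] ++ [::].
  by rewrite cats0 /block /fact_block size_rev prime_decompE size_map.
apply: (@tr_time _ _ _ _ ((15 * Omega (a + o) + 10) + ((21 * Omega (a + o) + 1) + 2).+2).+4); last by lia.
op; op; ld (o * (k + k)); rewrite ch; first by lia.
op; apply: tr_seq0; apply: tr_post; first by apply: cofactor_spec Hh Hr; rewrite // addnC.
move=> _ [i1 [p1 [m1 [e1 [t1 [h1 [-> Hh1]]]]]]].
apply: tr_out => //; apply: tr_out => //=.
apply: tr_seq; apply: tr_post.
  apply: emit_spec Hh1 _ => //; first by rewrite /upd eqxx.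
  exact: rows_ok_upd.
move=> _ [p2 [m2 [e2 [t2 [h2 [-> Hh2]]]]]].
have H3 : hinv L w (set_nth 0 h2 (o * w) 0) (upd cn o 0) (upd S o [::]) g.
  apply: (hinv_ext (hinv_count 0 Hh2 lo _)) => //; first by rewrite /w; lia.
  by move=> o' _; rewrite /upd; case: eqP.
str (o * (k + k)).
  apply: heap_okI H3 _ (leqnn r); apply: rows_ok_count => //.
  by apply: rows_ok_upd => //; rewrite big_nil; lia.
op; apply: tr_skip; do 9!eexists; split; last exact: H3.
by rewrite addn1.
Qed.

Lemma output_spec a len i p o c m n e t u h cn :
  0 < a -> a + len <= x.+1 -> len <= L ->
  (forall o, o < L -> cn o = size (seg_row a len o)) ->
  hinv L w h cn (seg_row a len) g ->
  tr output_code (st cnt a len i p o c n m e t u, h)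
    (36 * (\sum_(0 <= j < len) Omega (a + j)) + 23 * len + 3)
  (flatten [seq block (a + j) | j <- iota 0 len])
  (fun s' => exists i p o c n m e t u h' cn',
     [/\ s' = (st cnt a len i p o c n m e t u, h'),
     hinv L w h' cn' (fun=> [::]) g & forall o, o < L -> cn' o = 0]).
Proof.
move=> a0 le_a le_L Hc Hh.
pose row j o := if o < j then [::] else seg_row a len o.
rewrite -[flatten _]cats0; apply: (@tr_time _ _ _ _
  ((\sum_(0 <= j < len) (1 + (36 * Omega (a + j) + 20)).+2 + 1.+1) + 0).+1).
  cst; apply: tr_seq; apply: tr_post.
    apply: (@tr_for _ _ _ _ _ len 1 (fun j s => exists i p c n m e t u h' cn',
     [/\ s = (st cnt a len i p j c n m e t u, h'),
         hinv L w h' cn' (row j) g &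
         forall o', o' < L -> cn' o' = size (row j o')]) (fun j => 36 * Omega (a + j) + 20)
       (fun j => block (a + j))
     (fun s' => exists i p o c n m e t u h' cn',
     [/\ s' = (st cnt a len i p o c n m e t u, h'),
     hinv L w h' cn' (fun=> [::]) g & forall o, o < L -> cn' o = 0])).
  - move=> j _ lt_j [i1 [p1 [c1 [n1 [m1 [e1 [t1 [u1 [h1 [cn1 [-> Hh1 Hc1]]]]]]]]]]].
    op; apply: tr_skip; split=> //; first by rewrite /reg /=; lia.
    have lt_jL : j < L by lia.
    have ej : row j j = drow (primes_below r) (a + j) by rewrite /row ltnn /seg_row lt_j.
    apply: tr_post; first apply: (@output_one_spec _ _ _ _ _ _ _ _ _ _ _ _ cn1 (row j)) => //.
    + by rewrite Hc1.
    + move=> o' lt_o'; rewrite Hc1 // /row /seg_row.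
      have z : [/\ 0 <= k + k, all (leq 2) [::] & \prod_(p <- [::]) p <= x].
        by rewrite big_nil; split=> //; lia.
      case: ifP => // _; case: ifP => // lt'.
      have [||||f1 f2 /ltnW f3] := @drow_facts (primes_below r) (a + o') => //; try by lia.
        exact: primes_below_uniq.
      by apply/allP=> q; rewrite mem_primes_below => /andP[].
    move=> _ [i2 [p2 [c2 [n2 [m2 [e2 [t2 [u2 [h2 [-> Hh2]]]]]]]]]].
    have er o' : row j.+1 o' = upd (row j) j [::] o'.
      by rewrite /row /upd ltnS; case: ltngtP.
    do 10!eexists; split; first reflexivity.
      by apply: hinv_ext Hh2 _ _ => // o' _.
    by move=> o' lt_o'; rewrite er /upd; case: eqP => // _; rewrite Hc1.
  - move=> _ [i1 [p1 [c1 [n1 [m1 [e1 [t1 [u1 [h1 [cn1 [-> Hh1 Hc1]]]]]]]]]]].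
    op; apply: tr_skip; split=> //; first by rewrite /reg /=; lia.
    have er o' : row len o' = [::].
      by rewrite /row /seg_row; case: (o' < len).
    do 11!eexists; split; first reflexivity.
      by apply: hinv_ext Hh1 _ _ => // o' _.
    by move=> o' lt_o'; rewrite Hc1 // er.
  - have e0 o' : row 0 o' = seg_row a len o' by [].
    do 10!eexists; split; first reflexivity.
      by apply: hinv_ext Hh _ _ => // o' _.
    by move=> o' lt_o'; rewrite e0 Hc.
  - by move=> s' H; apply: tr_skip.
have -> : \sum_(0 <= j < len) (1 + (36 * Omega (a + j) + 20)).+2 =
   36 * (\sum_(0 <= j < len) Omega (a + j)) + len * 23.
  rewrite big_distrr /= -[len in X in _ = _ + X]subn0 -sum_nat_const_nat -big_split /=.
  by apply: eq_bigr => j _; lia.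
lia.
Qed.

(** * One segment, and the loop over all segments *)

Lemma segment_spec a len i p o c m n e u h cn : cnt = size (primes_below r) ->
  0 < a -> a <= x ->
  hinv L w h cn (fun=> [::]) g -> (forall o, o < L -> cn o = 0) ->
  let len' := minn L (x.+1 - a) in
  tr segment_code (st cnt a len i p o c n m e (x.+1 - a) u, h)
    (47 * (\sum_(0 <= j < len') Omega (a + j)) + 14 * cnt + 23 * L + 10)
  (flatten [seq block (a + j) | j <- iota 0 len'])
  (fun s' => exists len i p o c n m e t u h' cn',
     [/\ s' = (st cnt (a + L) len i p o c n m e t u, h'),
     hinv L w h' cn' (fun=> [::]) g & forall o, o < L -> cn' o = 0]).
Proof.
move=> ecnt a0 le_a Hh Hc len'; have le_L : len' <= L by rewrite /len'; lia.
have le_l : a + len' <= x.+1 by rewrite /len'; lia.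
rewrite -[flatten _]cats0.
apply: (@tr_time _ _ _ _ ((14 * cnt + 11 * (\sum_(0 <= j < len') Omega (a + j)) + 4) +
  ((36 * (\sum_(0 <= j < len') Omega (a + j)) + 23 * len' + 3) + 1)).+2); last by lia.
op; op; have -> : L - (L - (x.+1 - a)) = len' by rewrite /len'; lia.
apply: tr_seq0; apply: tr_post; first by apply: sieve_spec Hh Hc.
move=> _ [i1 [p1 [o1 [c1 [t1 [u1 [h1 [cn1 [-> Hh1 Hc1]]]]]]]]].
apply: tr_seq; apply: tr_post; first by apply: output_spec Hc1 Hh1.
move=> _ [i2 [p2 [o2 [c2 [n2 [m2 [e2 [t2 [u2 [h2 [cn2 [-> Hh2 Hc2]]]]]]]]]]]].
op; apply: tr_skip; do 12!eexists; split; [reflexivity|exact: Hh2|exact: Hc2].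
Qed.

(** Segments beyond [x] get length 0 by truncated subtraction, so the induction on [N] needs no
    bound relating [N] to [x]. *)
Lemma iota_segments (T : Type) (f : nat -> seq T) N :
  flatten [seq flatten [seq f (1 + z * L + j) | j <- iota 0 (minn L (x.+1 - (1 + z * L)))]
          | z <- iota 0 N] = flatten [seq f n | n <- iota 1 (minn (N * L) x)].
Proof.
elim: N => [|N IH]; first by rewrite mul0n min0n.
have -> : iota 0 N.+1 = iota 0 N ++ [:: N] by rewrite -addn1 iotaD.
rewrite map_cat flatten_cat IH /= cats0.
have -> : minn (N.+1 * L) x = minn (N * L) x + minn L (x.+1 - (1 + N * L)) by lia.
rewrite iotaD map_cat flatten_cat; congr (_ ++ flatten _).
have [le|gt] := leqP (N * L) x; last first.
  by have -> : minn L (x.+1 - (1 + N * L)) = 0 by lia.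
move: (minn L _) => len; rewrite -[in RHS](addn0 (1 + N * L)) iotaDl -map_comp.
exact: eq_map.
Qed.

Lemma sum_segments (f : nat -> nat) N :
  \sum_(0 <= z < N) \sum_(0 <= j < minn L (x.+1 - (1 + z * L))) f (1 + z * L + j) =
  \sum_(1 <= n < (minn (N * L) x).+1) f n.
Proof.
elim: N => [|N IH]; first by rewrite mul0n min0n !big_geq.
rewrite big_nat_recr //= IH.
have -> : minn (N.+1 * L) x = minn (N * L) x + minn L (x.+1 - (1 + N * L)) by lia.
rewrite [RHS](@big_cat_nat _ _ _ (minn (N * L) x).+1) //=; last by lia.
congr (_ + _); have [le|gt] := leqP (N * L) x; last first.
  by have -> : minn L (x.+1 - (1 + N * L)) = 0; [lia | rewrite !big_geq //; lia].
move: (minn L _) => len; have -> : (N * L + len).+1 = len + (N * L).+1 by lia.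
rewrite -[X in \sum_(X <= _ < _ + _) _]add0n big_addn addnK.
by apply: eq_bigr => j _; rewrite addnC add1n.
Qed.

(** The two inequalities say that [N] is [x/L] rounded up: the segments cover everything up to [x],
    and the last one is not empty. *)
Lemma segments_spec i p o c m n e t u h N : cnt = size (primes_below r) ->
  x <= N * L -> N * L < x + L ->
  hinv L w h (fun=> 0) (fun=> [::]) g ->
  tr (While (IOp OAdd vt vx vone ;; IOp OSub vt vt va ;; Skip) vt segment_code)
    (st cnt 1 0 i p o c n m e t u, h)
    (47 * (\sum_(1 <= n < x.+1) Omega n) + N * (14 * cnt + 23 * L + 14) + 3)
  (flatten [seq block n | n <- iota 1 x]) (fun=> True).
Proof.
move=> ecnt le_N lt_N Hh.
pose F z := 47 * (\sum_(0 <= j < minn L (x.+1 - (1 + z * L))) Omega (1 + z * L + j)) + 14 * cnt + 23 * L + 10.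
have e_x : minn (N * L) x = x by lia.
have := iota_segments block N; rewrite e_x => <-.
apply: (@tr_time _ _ _ _ (\sum_(0 <= z < N) (2 + F z).+2 + 2.+1)).
  apply: (@tr_for _ _ _ _ _ N 2 (fun z s => exists len i p o c n m e t u h' cn',
     [/\ s = (st cnt (1 + z * L) len i p o c n m e t u, h'),
     hinv L w h' cn' (fun=> [::]) g & forall o, o < L -> cn' o = 0]) F (fun z =>
      flatten [seq block (1 + z * L + j) | j <- iota 0 (minn L (x.+1 - (1 + z * L)))])).
  - move=> z _ lt_z [len1 [i1 [p1 [o1 [c1 [n1 [m1 [e1 [t1 [u1 [h1 [cn1 [-> Hh1 Hc1]]]]]]]]]]]]].
    have le_z : z.+1 * L <= N * L by rewrite leq_mul2r lt_z orbT.
    rewrite mulSn in le_z.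
    op; op; apply: tr_skip; split=> //; first by rewrite /reg /=; lia.
    rewrite addn1; apply: tr_post; first apply: segment_spec Hh1 Hc1 => //; first by lia.
    move=> _ [len2 [i2 [p2 [o2 [c2 [n2 [m2 [e2 [t2 [u2 [h2 [cn2 [-> Hh2 Hc2]]]]]]]]]]]]].
    do 12!eexists; split; [|exact: Hh2|exact: Hc2].
    by congr ([:: _; _; _; _; _; _; _; _; _; _; _; _; _; _; _; _; _; _; _; _; _], _); lia.
  - move=> _ [len1 [i1 [p1 [o1 [c1 [n1 [m1 [e1 [t1 [u1 [h1 [cn1 [-> Hh1 Hc1]]]]]]]]]]]]].
    op; op; apply: tr_skip; split=> //; rewrite /reg /=; lia.
  - by do 12!eexists; split; [reflexivity|exact: Hh|].
have -> : \sum_(0 <= z < N) (2 + F z).+2 =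
   47 * (\sum_(0 <= z < N) \sum_(0 <= j < minn L (x.+1 - (1 + z * L))) Omega (1 + z * L + j)) +
   N * (14 * cnt + 23 * L + 14).
  rewrite big_distrr /= -[N in X in _ = _ + X]subn0 -sum_nat_const_nat -big_split /=.
  by apply: eq_bigr => z _; rewrite /F; lia.
by rewrite sum_segments e_x.
Qed.

End Phases.

(** * Choice of the parameters *)

(** Once expanded, the goal is linear in the products [r * r], [N * cnt], [N * L] and [x * l], which
    are treated as atoms. *)
Lemma total_time_le x k l r N L cnt s : 3 <= x -> r * r <= 4 * x -> r <= 2 * x ->
  k <= r -> l <= k -> N * L <= 4 * x -> N <= 4 * x -> N * cnt <= 64 * x * l -> x <= x * l ->
  s <= 64 * x * l.+1 ->
  (7 * k + 6 * l + 17) + ((r * (4 * r + 20) + 10) +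
   ((47 * s + N * (14 * cnt + 23 * L + 14) + 3) + 0).+1) < 100 * 80 * x * l.
Proof.
have -> : r * (4 * r + 20) = 4 * (r * r) + 20 * r by lia.
have -> : N * (14 * cnt + 23 * L + 14) = 14 * (N * cnt) + 23 * (N * L) + 14 * N by lia.
have -> : 64 * x * l.+1 = 64 * (x * l) + 64 * x by lia.
rewrite -!mulnA; move: (r * r) (N * cnt) (N * L) (x * l) => a b c d.
lia.
Qed.

Section Main.
Variables (x k l : nat).
Hypotheses (x3 : 3 <= x) (k0 : 0 < k) (k_lo : 4 ^ k.-1 <= x) (k_hi : x < 4 ^ k)
  (l0 : 0 < l) (l_lo : 2 ^ l.-1 <= k) (l_hi : k < 2 ^ l).

Let r := 2 ^ k.
Let L := r %/ (k * l) + 1.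
Let cnt := size (primes_below r).
Let B := x ^ 6.

Lemma r_sqr : r * r = 4 ^ k.
Proof. by rewrite /r -expnMn. Qed.

Lemma pow4_pred : 4 ^ k = 4 * 4 ^ k.-1.
Proof. by rewrite -expnS prednK. Qed.

Lemma parameter_bounds :
  [/\ 40 * x + 100 <= B, 2 <= r, r <= 2 * x, x < r * r & r * r <= 4 * x] /\
  [/\ k <= r, 0 < L, L <= 3 * x, L * (k + k) <= 8 * x & cnt <= r] /\
  [/\ l <= k, k * l <= 2 * r, r < L * (k * l), L * (k * l) <= 3 * r & 2 ^ l <= 2 * k].
Proof.
have p4 := pow4_pred; have rr := r_sqr.
have r2 : 2 <= r by rewrite /r -{1}(expn1 2) leq_exp2l.
have k_r : k <= r by apply/ltnW/ltn_expl.
have r4 : r * r <= 4 * x by rewrite rr p4 leq_mul2l k_lo.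
have rx : r <= 2 * x by have : 2 * r <= r * r by [rewrite leq_mul2r r2 orbT]; lia.
have lk : l <= k.
  by have := ltn_expl l.-1 (isT : 1 < 2); lia.
(* The [+ 1] in [L] adds [k * l] to [L * (k * l)]; this bound keeps that product of order [r]. *)
have kl : k * l <= 2 * r.
  by apply: leq_trans (leq_mul (leqnn k) lk) _; rewrite /r -expnS; apply: sqr_le_exp2.
have kl0 : 0 < k * l by rewrite muln_gt0 k0.
have Lkl1 : r < L * (k * l) by rewrite /L addn1; apply: ltn_ceil.
have Lkl2 : L * (k * l) <= 3 * r.
  by rewrite /L mulnDl mul1n; have := leq_trunc_div r (k * l); lia.
have Lk : L * k <= 3 * r.
  by apply: leq_trans Lkl2; rewrite leq_mul2l leq_pmulr ?orbT.
have Lr : L <= r + 1 by rewrite /L leq_add2r leq_div.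
have cr : cnt <= r.
  by rewrite /cnt size_filter; apply: leq_trans (count_size _ _) _; rewrite size_iota.
have l2 : 2 ^ l <= 2 * k by rewrite -(prednK l0) expnS leq_mul2l l_lo.
(* For [x >= 3] one has [x ^ 5 >= 3 ^ 5 = 243]. *)
have hB : 40 * x + 100 <= B.
  have : 243 * x <= B by rewrite /B expnSr leq_mul2r (@leq_exp2r 3 x 5) // x3 orbT.
  lia.
have Lk2 : L * (k + k) <= 8 * x.
  have e : L * (k + k) = 2 * (r %/ (k * l) * k) + 2 * k.
    by rewrite /L mulnDl; lia.
  have : r %/ (k * l) * k <= r.
    apply: leq_trans (leq_trunc_div r (k * l)).
    by rewrite leq_mul2l leq_pmulr ?orbT.
  lia.
by split; [|split]; split=> //; [rewrite rr | rewrite /L addn1 | lia].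
Qed.

Local Notation st L cnt a len i p o c n m e t u := 
  ([:: x; 1; 21; r; k; l; L; k + k; L * (k + k) + 21; cnt; a; len; i; p; o; c; n; m; e; t; u] : seq nat).

Lemma init_spec (G : seq nat -> Prop) :
  tr B G init_code (x :: nseq 20 0, [::]) (7 * k + 6 * l + 17) [::]
  (fun s => exists t u, s = (st L 0 0 0 0 0 0 0 0 0 0 t u, [::])).
Proof.
have [[hB r2 rx xr r4] [[kr L0 Lx Lkx cr] [lk kl Lkl1 Lkl2 l2]]] := parameter_bounds.
apply: (@tr_time _ _ _ _ ((k * (3 + 2).+2 + 3.+1) + ((l * (3 + 1).+2 + 3.+1) + 6)).+3); last by lia.
cst; cst; cst; apply: tr_seq0; apply: tr_post.
  apply: (@tr_forc _ _ _ _ _ k 3 2 (fun j s => exists t u, s =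
    ([:: x; 1; 21; 2 ^ j; j; 0; 0; 0; 0; 0; 0; 0; 0; 0; 0; 0; 0; 0; 0; t; u] : seq nat, [::] : seq nat))
    (fun s => exists t u, s =
    ([:: x; 1; 21; r; k; 0; 0; 0; 0; 0; 0; 0; 0; 0; 0; 0; 0; 0; 0; t; u], [::]))).
  - move=> j _ lt_j [t [u ->]].
    have le_x : 2 ^ j * 2 ^ j <= x.
      by rewrite -expnMn; apply: leq_trans k_lo; rewrite leq_exp2l //; lia.
    have lt_r : 2 ^ j <= 2 ^ j * 2 ^ j by rewrite leq_pmulr // expn_gt0.
    op; op; op; apply: tr_skip; split=> //; first by rewrite /reg /=; lia.
    op; op; apply: tr_skip; do 2!eexists.
    by congr ([:: _, _, _, _, _ & _], _); rewrite ?expnS; lia.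
  - move=> _ [t [u ->]]; rewrite -/r; op; op; op.
    apply: tr_skip; split=> //; first by rewrite /reg /=; lia.
    by do 2!eexists.
  - by exists 0, 0.
move=> _ [t1 [u1 ->]]; apply: tr_seq0; apply: tr_post.
  apply: (@tr_forc _ _ _ _ _ l 3 1 (fun j s => exists t u, s =
    ([:: x; 1; 21; r; k; j; 0; 0; 0; 0; 0; 0; 0; 0; 0; 0; 0; 0; 0; t; u] : seq nat, [::] : seq nat))
    (fun s => exists t u, s =
    ([:: x; 1; 21; r; k; l; 0; 0; 0; 0; 0; 0; 0; 0; 0; 0; 0; 0; 0; t; u], [::]))).
  - move=> j _ lt_j [t [u ->]].
    have le_k : 2 ^ j <= k by apply: leq_trans l_lo; rewrite leq_exp2l //; lia.
    op; op; op; apply: tr_skip; split=> //; first by rewrite /reg /=; lia.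
    by op; apply: tr_skip; do 2!eexists; rewrite addn1.
  - move=> _ [t [u ->]]; op; op; op.
    apply: tr_skip; split=> //; first by rewrite /reg /=; lia.
    by do 2!eexists.
  - by do 2!eexists.
move=> _ [t2 [u2 ->]].
have le_d := leq_div r (k * l).
op; op; op; rewrite -/L; op; op; op.
by apply: tr_skip; do 2!eexists.
Qed.

Lemma program_spec : exists s' t,
  bigstep B (heap_ok L k x r) sieve_program (x :: nseq 20 0, [::]) t
    (flatten [seq block n | n <- iota 1 x]) s' /\ t < 100 * 80 * x * l.
Proof.
have [[hB r2 rx xr r4] [[kr L0 Lx Lkx cr] [lk kl Lkl1 Lkl2 l2]]] := parameter_bounds.
set N := (x + L - 1) %/ L.
have N1 : N * L <= x + L - 1 by apply: leq_trunc_div.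
have N2 : x + L - 1 < N.+1 * L by apply: ltn_ceil.
rewrite mulSn in N2.
pose T := (7 * k + 6 * l + 17) + ((r * (4 * r + 20) + 10) +
  ((47 * (\sum_(1 <= n < x.+1) Omega n) + N * (14 * cnt + 23 * L + 14) + 3) + 0).+1).
have : tr B (heap_ok L k x r) sieve_program (x :: nseq 20 0, [::]) T
   (flatten [seq block n | n <- iota 1 x]) (fun=> True).
  apply: tr_seq0; apply: tr_post; first exact: init_spec.
  move=> _ [t1 [u1 ->]]; apply: tr_seq0; apply: tr_post.
    by apply: primes_spec; try exact: hinv_nil.
  move=> _ [p2 [n2 [e2 [t2 [u2 [h2 [-> Hh2]]]]]]]; cst.
  rewrite -[flatten _]cats0; apply: tr_seq; apply: tr_post; last by move=> *; apply: tr_skip.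
  by apply: segments_spec Hh2 => //; lia.
move=> [t [s' [b le_t _]]]; exists s', t; split=> //.
(* The exponent of [4 ^ k = 2 ^ (2 * k)] satisfies [2 * k <= 2 ^ l.+1], whence [l.+1]. *)
have O1 : \sum_(1 <= n < x.+1) Omega n <= 64 * x * l.+1.
  apply: sum_Omega_le; apply: leq_trans k_hi _.
  by rewrite -[4]/(2 ^ 2) -expnM leq_exp2l // expnS; lia.
(* From [k * cnt <= 16 * r] and [r < L * (k * l)]: running through all primes costs [O(l)] per
   integer of a segment. *)
have c1 : cnt <= 16 * l * L.
  have := size_primes_below k; rewrite -/r -/cnt => H.
  by rewrite -(leq_pmul2l k0); lia.
have Nc : N * cnt <= 64 * x * l.
  apply: leq_trans (leq_mul (leqnn N) c1) _.
  have -> : N * (16 * l * L) = 16 * l * (N * L) by lia.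
  have -> : 64 * x * l = 16 * l * (4 * x) by lia.
  by rewrite leq_mul2l; apply/orP; right; lia.
have NN : N <= N * L by rewrite leq_pmulr.
have xl : x <= x * l by rewrite leq_pmulr.
have NL : N * L <= 4 * x by apply: leq_trans N1 _; move: Lx; clear; lia.
exact: leq_ltn_trans le_t (total_time_le x3 r4 rx kr lk NL (leq_trans NN NL) Nc xl O1).
Qed.

Lemma size_primes_below_le b : b <= r -> size (primes_below b) <= cnt.
Proof.
by move=> le_b; rewrite /cnt -(subnKC le_b) /primes_below iotaD filter_cat size_cat leq_addr.
Qed.

Lemma sum_gaps_le b : \sum_(v <- gaps (primes_below b)) v <= b.
Proof.
rewrite sum_gaps; last first.
  by apply: sub_sorted (sorted_primes_below b) => i j /ltnW.
have := mem_last 0 (primes_below b); rewrite inE => /orP[/eqP->//|].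
by rewrite mem_primes_below => /andP[_ /ltnW].
Qed.

(** After multiplication by [l] every contribution is [O(r)]: the registers since [k * l <= 2 * r],
    the rows since [L * (k * l) <= 3 * r], and the gaps since [cnt * k <= 16 * r] and
    [l^2 = O(k)]. *)
Lemma good_space m : good B (heap_ok L k x r) 21 m -> space m * l <= 800 * 2 ^ k.
Proof.
have [[hB r2 rx xr r4] [[kr L0 Lx Lkx cr] [lk kl Lkl1 Lkl2 l2]]] := parameter_bounds.
move=> [rg [h [-> sz /allP aB [cn [s [b [Hh Hr le_b]]]]]]].
have -> : space (rg ++ h) = space rg + space h by rewrite /space map_cat sumn_cat.
(* Registers are at most [x ^ 6 < 4 ^ (6 * k) = 2 ^ (12 * k)]. *)
have Srg : space rg <= 21 + 21 * (12 * k).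
  rewrite spaceE sz leq_add2l -sz -[size rg * _]mulnC -iter_addn_0 -[size rg]count_predT -big_const_seq.
  rewrite big_seq [X in _ <= X]big_seq; apply: leq_sum => v /aB le_v; apply: bitlen_le.
  apply: leq_ltn_trans le_v _; rewrite /B mulnC -[12]/(2 * 6) mulnA [k * _]mulnC expnM ltn_exp2r //.
  by rewrite expnM.
have Sh : space h <= L * (k + k) + cnt + (L * (6 * k) + (cnt * l + r %/ 2 ^ l)).
  (* A row takes [4 * k] bits for its entries and, crudely, [2 * k] for its count. *)
  have := hinv_space (b := 6 * k) Hh; rewrite size_gaps => H.
  apply: leq_trans (H _) _.
    move=> o /Hr[c1 c2 c3]; have := sum_bitlen_row c2 c3 k_hi; have := bitlen_leq (cn o); lia.
  have sb := size_primes_below_le le_b.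
  have := sum_bitlen_gaps (gaps (primes_below b)) l; rewrite size_gaps => Hg.
  have : (\sum_(v <- gaps (primes_below b)) v) %/ 2 ^ l <= r %/ 2 ^ l.
    by apply: leq_div2r; apply: leq_trans (sum_gaps_le b) le_b.
  have : size (primes_below b) * l <= cnt * l by rewrite leq_mul2r sb orbT.
  lia.
have c1 : k * cnt <= 16 * r by apply: size_primes_below.
have c2 : cnt * (l.+1 * l.+1) <= 128 * r.
  have : l.+1 * l.+1 <= 8 * k by apply: leq_trans (sqr_le_exp2 _) _; rewrite !expnS; lia.
  by move=> H; apply: leq_trans (leq_mul (leqnn cnt) H) _; lia.
have c3 : r %/ 2 ^ l * l <= r.
  apply: leq_trans (leq_trunc_div r (2 ^ l)); rewrite leq_mul2l.
  by apply/orP; right; apply/ltnW/ltn_expl.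
apply: leq_trans (leq_mul (leq_add Srg Sh) (leqnn l)) _.
rewrite -/r; move: (r %/ 2 ^ l) c3 => z c3.
have -> : (21 + 21 * (12 * k) + (L * (k + k) + cnt + (L * (6 * k) + (cnt * l + z)))) * l
  = 21 * l + 252 * (k * l) + 8 * (L * (k * l)) + cnt * (l.+1 * l) + z * l by lia.
have : cnt * (l.+1 * l) <= cnt * (l.+1 * l.+1) by rewrite !leq_mul2l leqnSn !orbT.
lia.
Qed.

(** A row entry is at most the product of its row, and a gap at most the sum of all gaps. *)
Lemma good_words m : good B (heap_ok L k x r) 21 m -> all (fun v => v <= x ^ 6) m.
Proof.
have [[hB r2 rx xr r4] [[kr L0 Lx Lkx cr] [lk kl Lkl1 Lkl2 l2]]] := parameter_bounds.
move=> [rg [h [-> sz aB [cn [s [b [[H1 H2 H3] Hr le_b]]]]]]]; rewrite all_cat aB /=.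
apply/(all_nthP 0) => i lt_i; apply: leq_trans (_ : 4 * x <= _); last by rewrite -/B; lia.
have [lt|ge] := ltnP i (L * (k + k)).
  have w0 : 0 < k + k by lia.
  have lt_o : i %/ (k + k) < L by rewrite ltn_divLR.
  rewrite (divn_eq i (k + k)) H1 ?ltn_mod //.
  have [c1 c2 c3] := Hr _ lt_o.
  case: (i %% (k + k)) => [|j] /=; first by move: c1 kr rx; clear; lia.
  have [lt_j|ge_j] := ltnP j (size (s (i %/ (k + k)))); last by rewrite nth_default.
  apply: leq_trans (_ : x <= _); last by lia.
  apply: leq_trans c3; set v := nth _ _ _; have vs := mem_nth 0 lt_j.
  rewrite (perm_big _ (perm_to_rem vs)) big_cons leq_pmulr // big_seq.
  by apply: prodn_cond_gt0 => q /mem_rem /(allP c2) /ltnW.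
rewrite -(subnKC ge) H2; apply: leq_trans (_ : r <= _); last by lia.
apply: leq_trans le_b.
apply: leq_trans (sum_gaps_le b); move: (i - _) => j.
have [lt_j|ge_j] := ltnP j (size (gaps (primes_below b))); last by rewrite nth_default.
by rewrite (perm_big _ (perm_to_rem (mem_nth 0 lt_j))) big_cons leq_addr.
Qed.

End Main.

(** * Iterated logarithms *)

Section LogLog.
Local Open Scope R_scope.

Lemma leq_INR m n : (m <= n)%N -> INR m <= INR n.
Proof. by move/leP/le_INR. Qed.

Lemma INR_expn a b : INR (a ^ b)%N = INR a ^ b.
Proof. by elim: b => [|b IH] //; rewrite expnS -multE mult_INR IH. Qed.

Lemma ln_ge1 y : 0 < y -> ln y <= y - 1.
Proof.
move=> y0; have := exp_ineq1_le (ln y); rewrite exp_ln //; lra.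
Qed.

Lemma ln_le_mono a b : 0 < a -> a <= b -> ln a <= ln b.
Proof. by move=> a0 [/(ln_increasing _ _ a0)/Rlt_le|->]; lra. Qed.

(** From [exp (-1/6) >= 5/6] follows [e <= (6/5)^6 < 3]; with fifths the same estimate gives
    [(5/4)^5 > 3], which is too weak. *)
Lemma ln3_gt1 : 1 < ln 3.
Proof.
have e6 : exp 1 = (exp (1 / 6)) ^ 6.
  by rewrite /= Rmult_1_r -!exp_plus; congr exp; field.
have h := exp_ineq1_le (- (1 / 6)).
have e1 : exp (1 / 6) * exp (- (1 / 6)) = 1 by rewrite -exp_plus Rplus_opp_r exp_0.
have p := exp_pos (1 / 6).
have le6 : exp (1 / 6) <= 6 / 5 by nra.
have : exp 1 < 3.
  rewrite e6; apply: Rle_lt_trans (_ : (6 / 5) ^ 6 < 3); last by lra.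
  by apply: pow_incr; lra.
by move=> lt; rewrite -{1}(ln_exp 1); apply: ln_increasing lt; apply: exp_pos.
Qed.

(** [ln x <= k ln 4 <= 2^(l+2)], so [ln (ln x) <= (l+2) ln 2 <= l + 2 <= 3 l]. *)
Lemma lnln_le x k l : (3 <= x)%N -> (x < 4 ^ k)%N -> (k < 2 ^ l)%N -> (0 < l)%N ->
  ln (ln (INR x)) <= 3 * INR l.
Proof.
move=> x3 xk kl l0.
have X3 : 3 <= INR x by have := leq_INR x3; rewrite /=; lra.
have L1 : 1 < ln (INR x) by apply: Rlt_le_trans ln3_gt1 _; apply: ln_le_mono; lra.
have K : INR k <= 2 ^ l by rewrite -(INR_expn 2 l); apply/leq_INR/ltnW.
have X : ln (INR x) <= INR k * ln 4.
  rewrite -ln_pow; last by lra.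
  apply: ln_le_mono; first by lra.
  have -> : 4 = INR 4 by rewrite /=; lra.
  by rewrite -INR_expn; apply/leq_INR/ltnW.
have ln4 := @ln_ge1 4 ltac:(lra).
have p2 : 0 < 2 ^ l by apply: pow_lt; lra.
have X' : ln (INR x) <= 2 ^ (l + 2)%N.
  have -> : 2 ^ (l + 2)%N = 2 ^ l * 4 by rewrite -plusE pow_add /=; lra.
  have := pos_INR k; nra.
have := @ln_le_mono (ln (INR x)) _ ltac:(lra) X'.
rewrite ln_pow; last by lra.
have ln2 := @ln_ge1 2 ltac:(lra).
rewrite -plusE plus_INR /=; have := leq_INR l0; rewrite /= => ?.
have := ln_lt_2; nra.
Qed.

(** For [k >= 2], [2^k <= 4^(k-1) <= x] gives [2^(l-1) ln 2 <= ln x], and a second logarithm bounds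
    [l - 1] by [(ln (ln x) + A) / ln 2]. The constant terms are absorbed because
    [ln (ln x) >= ln (ln 3) > 0]. For [k = 1] also [l = 1]. *)
Lemma lnln_ge : exists C, 0 < C /\ forall x k l, (3 <= x)%N -> (0 < k)%N -> (0 < l)%N ->
  (4 ^ k.-1 <= x)%N -> (2 ^ l.-1 <= k)%N ->
  INR l <= C * ln (ln (INR x)).
Proof.
have c3 : 0 < ln (ln 3) by rewrite -ln_1; apply: ln_increasing ln3_gt1; lra.
have ln2 : 0 < ln 2 by have := ln_lt_2; lra.
set c := ln (ln 3) in c3 *; set A := Rabs (ln (ln 2)).
have A0 : 0 <= A by apply: Rabs_pos.
have Al : - A <= ln (ln 2) by rewrite /A; have := Rle_abs (- ln (ln 2)); rewrite Rabs_Ropp; lra.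
exists ((1 + A / ln 2) / c + / ln 2); split.
  have := Rinv_0_lt_compat _ ln2; have : 0 <= (1 + A / ln 2) / c; last by lra.
  apply: Rle_mult_inv_pos => //; have := Rle_mult_inv_pos _ _ A0 ln2; rewrite /Rdiv; lra.
move=> x k l x3 k0 l0 xk kl.
have X3 : 3 <= INR x by have := leq_INR x3; rewrite /=; lra.
have L3 : ln 3 <= ln (INR x) by apply: ln_le_mono; lra.
have LL : c <= ln (ln (INR x)) by apply: ln_le_mono L3; have := ln3_gt1; lra.
set y := ln (ln (INR x)) in LL *.
have Z : 0 <= A / ln 2 by apply: Rle_mult_inv_pos.
have H1 : 1 + A / ln 2 <= (1 + A / ln 2) / c * y.
  have : (1 + A / ln 2) / c * c <= (1 + A / ln 2) / c * y.
    by apply: Rmult_le_compat_l LL; apply: Rle_mult_inv_pos => //; lra.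
  have -> : (1 + A / ln 2) / c * c = 1 + A / ln 2 by field; lra.
  lra.
suff : INR l <= 1 + A / ln 2 + / ln 2 * y by lra.
have iy : 0 <= / ln 2 * y.
  by apply: Rmult_le_pos; [apply/Rlt_le/Rinv_0_lt_compat|lra].
case: (ltnP k 2) => k2.
  have -> : l = 1%N.
    case: l l0 kl => // [[|l]] //= _; rewrite expnS; have : (0 < 2 ^ l)%N by rewrite expn_gt0.
    by lia.
  by rewrite /=; lra.
have X : INR k * ln 2 <= ln (INR x).
  rewrite -ln_pow; last by lra.
  apply: ln_le_mono; first by apply: pow_lt; lra.
  rewrite -(INR_expn 2 k); apply: leq_INR; apply: leq_trans xk.
  have -> : (4 ^ k.-1 = 2 ^ (2 * k.-1))%N by rewrite expnM.
  by rewrite leq_exp2l //; lia.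
have K : 2 ^ l.-1 <= INR k by rewrite -(INR_expn 2 l.-1); apply: leq_INR.
have p2 : 0 < 2 ^ l.-1 by apply: pow_lt; lra.
have X' : 2 ^ l.-1 * ln 2 <= ln (INR x) by nra.
have := @ln_le_mono (2 ^ l.-1 * ln 2) _ ltac:(nra) X'.
rewrite ln_mult // ln_pow; last by lra.
rewrite -/y => Y.
have -> : INR l = INR l.-1 + 1 by rewrite -S_INR prednK.
have : INR l.-1 <= (y + A) / ln 2.
  apply: (Rmult_le_reg_r (ln 2)) => //.
  have -> : (y + A) / ln 2 * ln 2 = y + A by field; lra.
  lra.
have -> : (y + A) / ln 2 = A / ln 2 + / ln 2 * y by field; lra.
lra.
Qed.

Lemma exp2_le_sqrt x k : (4 ^ k.-1 <= x)%N -> (0 < k)%N ->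
  INR (2 ^ k)%N <= 2 * sqrt (INR x).
Proof.
move=> xk k0; rewrite -(prednK k0) INR_expn /=.
apply: Rmult_le_compat_l; first by lra.
rewrite -(sqrt_pow2 (2 ^ k.-1)); last by apply: pow_le; lra.
apply: sqrt_le_1_alt; have -> : (2 ^ k.-1) ^ 2 = INR (4 ^ k.-1)%N.
  rewrite INR_expn /= Rmult_1_r -Rpow_mult_distr; congr (_ ^ _); ring.
exact: leq_INR.
Qed.

End LogLog.

Theorem theorem1 :
  exists (P : program) (C : R) (K : nat),
    Rlt 0 C /\
    forall x : nat, (3 <= x)%N ->
      exists (tr : seq config) (out : seq nat),
        exec P (Config 0 [:: x]) tr out /\
        correct_factorizations x out /\
        (* time: number of executed operations *)
        Rle (INR (size tr).-1) (Rmult (Rmult C (INR x)) (ln (ln (INR x)))) /\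
        (* working space in bits, at every moment of the run *)
        (forall c, List.In c tr ->
           Rle (INR (space (cells c))) (Rdiv (Rmult C (sqrt (INR x))) (ln (ln (INR x))))) /\
        (* word size: all integers handled have O(log x) bits *)
        (forall c, List.In c tr -> all (fun v => (v <= x ^ K)%N) (cells c)).
Proof.
have [C1 [C1_gt0 HC1]] := lnln_ge.
(* Address 0 is taken by [IConst 20 0]: writing cell 20 extends the one-cell memory to 21 registers,
   the new ones being 0. *)
pose code := compile sieve_program 1.
(* 8000 is the constant of the time bound, with [l] at most [C1] times the iterated logarithm;
   [4800 = 800 * 2 * 3] comes from [good_space], [exp2_le_sqrt] and [lnln_le]. *)
exists (IConst 20 0 :: code), (Rplus (Rmult 8000 C1) 4800), 6.
split; first by lra.
move=> x x3; have le_x6 : (x <= x ^ 6)%N by rewrite -{1}(expn1 x) leq_pexp2l //; lia.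
pose k := (trunc_log 4 x).+1; pose l := (trunc_log 2 k).+1.
have k_lo : (4 ^ k.-1 <= x)%N by apply: trunc_logP => //; lia.
have k_hi : (x < 4 ^ k)%N by apply: trunc_log_ltn.
have l_lo : (2 ^ l.-1 <= k)%N by apply: trunc_logP.
have l_hi : (k < 2 ^ l)%N by apply: trunc_log_ltn.
have [s' [t [run lt_t]]] := @program_spec x k l x3 isT k_lo k_hi isT l_lo l_hi.
set B := (x ^ 6)%N in run; set G := heap_ok _ _ _ _ in run.
have g0 : sgood B G 21 (x :: nseq 20 0, [::]).
  split=> //=; first by rewrite le_x6.
  by exists (fun=> 0%N), (fun=> [::]), 0%N; split=> //; [exact: hinv_nil | exact: rows_ok_nil (ltnW (ltnW x3))].
have ats : at_pc (IConst 20 0 :: code) 1 code.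
  by exists [:: IConst 20 0], [::]; rewrite cats0.
have [tr [sz st]] := compile_correct run g0 ats.
set c' := Config (1 + size _) _ in st.
(* The program counter is past the end of the code, where [nth] returns its default [IHalt]. *)
have halt : step (IConst 20 0 :: code) c' = None.
  rewrite /step (_ : nth _ _ _ = IHalt) //; exact: nth_default.
have ex := steps_exec st halt.
have gd c : List.In c (rcons tr c') -> good B G 21 (cells c).
  rewrite -cats1 => /(@List.in_app_or _ _ _ _) [Hc|[<-|[]]].
    exact: steps_good st _ Hc.
  exact: good_state (bigstep_sgood run g0).
exists (Config 0 [:: x] :: rcons tr c'), (flatten [seq block n | n <- iota 1 x]).
have L0 : Rlt 0 (ln (ln (INR x))).
  rewrite -ln_1; apply: ln_increasing; first by lra.
  apply: Rlt_le_trans ln3_gt1 _; apply: ln_le_mono; first by lra.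
  by have := leq_INR x3; rewrite /=; lra.
have Ll := HC1 x k l x3 isT isT k_lo l_lo.
have Lu := lnln_le x3 k_hi l_hi isT.
have sp m : (space m * l <= 800 * 2 ^ k)%N ->
  Rle (INR (space m)) (Rdiv (Rmult (Rplus (Rmult 8000 C1) 4800) (sqrt (INR x))) (ln (ln (INR x)))).
  move/leq_INR; rewrite -!multE !mult_INR.
  have -> : INR 800 = IZR 800 by rewrite INR_IZR_INZ.
  have := exp2_le_sqrt k_lo isT; have := sqrt_pos (INR x); have := pos_INR (space m).
  move: (INR (space m)) (sqrt (INR x)) (INR (2 ^ k)) => a q z a0 q0 Hz Ha.
  apply: (Rmult_le_reg_r _ _ _ L0); rewrite /Rdiv Rmult_assoc Rinv_l ?Rmult_1_r; last by lra.
  apply: Rle_trans (Rmult_le_compat_l _ _ _ a0 Lu) _.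
  have := Rmult_le_pos _ _ (Rlt_le _ _ C1_gt0) q0; lra.
split; [|split; [|split; [|split]]].
- rewrite -[flatten _]cat0s; apply: exec_step ex => //.
- exists (iota 1 x), (fun n => rev (prime_decomp n)); split; first exact: perm_refl.
  by split=> [n|]; [rewrite perm_rev; exact: perm_refl | reflexivity].
(* The initial [IConst] is one step more than [t]; the strict bound on [t] leaves room for it. *)
- have -> : (size (Config 0 [:: x] :: rcons tr c')).-1 = t.+1 by rewrite /= size_rcons sz.
  move: (leq_INR lt_t); rewrite -!multE !mult_INR.
  have -> : INR 100 = IZR 100 by rewrite INR_IZR_INZ.
  have -> : INR 80 = IZR 80 by rewrite INR_IZR_INZ.
  have x0 := pos_INR x; move: (INR t.+1) => a Ha.
  have := Rmult_le_compat_l _ _ _ x0 Ll.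
  have := Rmult_le_pos _ _ x0 (Rlt_le _ _ L0); lra.
(* In the first configuration the registers do not exist yet, so its single cell is bounded
   directly. *)
- move=> c [<-|/gd H]; apply: sp; last exact: good_space H.
  rewrite /space /= addn0; have le_b : (bitlen x <= 2 * k)%N.
    by apply: bitlen_le; rewrite expnM.
  have [_ [_ [_ kl _ _ _]]] := @parameter_bounds x k l x3 isT k_lo k_hi isT l_lo l_hi.
  have {}le_b : ((bitlen x).+1 <= 3 * k)%N by rewrite /k in le_b *; lia.
  apply: leq_trans (leq_mul le_b (leqnn l)) _.
  by move: kl; clear; lia.
- move=> c [<-|/gd H]; last exact: good_words H.
  by apply/andP; split; [exact: le_x6 | ].
Qed.
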